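(* Let $B$ be a separable Banach space, let $p\in[1,\infty)$ and let $\mu,\nu\in\mathcal{P}_p(B)$ be such that $\mu\leq_{\mathrm{cx}}\nu$. Then there exist finitely-supported probability measures $\mu_n,\nu_n\in\mathcal{P}_p(B)$, $n\in\mathbb{N}$, such that $\mu_n\leq_{\mathrm{cx}}\nu_n$ for all $n\in\mathbb{N}$, and $\mu_n\to\mu$ and $\nu_n\to\nu$ in $\mathcal{P}_p(B)$. Moreover, one can additionally obtain that $\mu_n\leq_{\mathrm{cx}}\mu$ and $\nu_n\leq_{\mathrm{cx}}\nu$ for all $n\in\mathbb{N}$.
   Context: $\mathcal{P}_p(B)$ is the set of Borel probability measures $\mu$ on $B$ with $\int\|x\|^p\,\mu(dx)<\infty$, endowed with the $p$-Wasserstein distance $\mathcal{W}_p(\mu,\nu)=\left(\inf_{\pi}\int_{B\times B}\|x-y\|^p\,d\pi(x,y)\right)^{1/p}$, where the infimum runs over all Borel probabilities $\pi$ on $B\times B$ with first marginal $\mu$ and second marginal $\nu$; convergence in $\mathcal{P}_p(B)$ means convergence in $\mathcal{W}_p$. For probabilities $\mu,\nu$ on $B$ with finite first moment, $\mu\leq_{\mathrm{cx}}\nu$ (convex order) means $\int_B f\,d\mu\leq\int_B f\,d\nu$ for every Lipschitz convex function $f:B\to\mathbb{R}$. *)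

(* Defs.v *)
From HB Require Import structures.
From mathcomp Require Import all_boot all_order all_algebra.
From mathcomp Require Import all_classical all_reals all_analysis.

Set Implicit Arguments.
Unset Strict Implicit.
Unset Printing Implicit Defensive.

Import Order.TTheory GRing.Theory Num.Theory.
Import numFieldNormedType.Exports.

Local Open Scope classical_set_scope.
Local Open Scope ring_scope.

Definition separable (T : topologicalType) : Prop :=
  exists2 D : set T, countable D & dense D.

Notation borel T := (g_sigma_algebraType (@open T)).

Section wasserstein.
Context {R : realType} {B : completeNormedModType R}.
Implicit Types (p : R) (mu nu : probability (borel B) R).

(* The set P_p(B). *)
Definition wasserstein_space p : set (probability (borel B) R) :=
  [set mu : probability (borel B) R |
    (\int[mu]_x (`|x : B| `^ p)%:E < +oo)%E].

(* Couplings live on the Borel sigma-algebra of the product topology. *)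
Definition coupling mu nu : set (probability (borel (B * B)%type) R) :=
  [set pi : probability (borel (B * B)%type) R | forall A : set (borel B), measurable A ->
    pushforward pi (fst : borel (B * B)%type -> borel B) A = mu A /\
    pushforward pi (snd : borel (B * B)%type -> borel B) A = nu A].

Definition wasserstein p mu nu : \bar R :=
  poweR (ereal_inf [set (\int[pi]_z (`|z.1 - z.2 : B| `^ p)%:E)%E
                   | pi in coupling mu nu]) p^-1.

(* Meaningful for mu and nu with finite first moment, as all integrals are then
   finite. *)
Definition convex_order mu nu : Prop :=
  forall f : B -> R^o, lipschitz f ->
    convex_function (setT : set (convex_lmodType B)) f ->
    (\int[mu]_x (f x)%:E <= \int[nu]_x (f x)%:E)%E.

(* A finite set is closed, hence Borel, as B is Hausdorff. *)
Definition finitely_supported mu : Prop :=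
  exists2 S : set B, finite_set S & mu S = 1%E.

End wasserstein.

(* Main.v *)
Require Import Defs.
From HB Require Import structures.
From mathcomp Require Import all_boot all_order all_algebra.
From mathcomp Require Import all_classical all_reals all_analysis.
From mathcomp Require Import measurable_realfun.
From mathcomp Require Import ring lra.

Set Implicit Arguments.
Unset Strict Implicit.
Unset Printing Implicit Defensive.

Import Order.TTheory GRing.Theory Num.Theory.
Import numFieldNormedType.Exports.

Local Open Scope classical_set_scope.
Local Open Scope ring_scope.

(** Given a martingale (X, Y) with X of law mu and Y of law nu, one would
average X over the cells of a finite partition and then, inside each of the
resulting events, average Y over the cells of another finite partition. The
two laws obtained are finitely supported, conditional Jensen inequalities give
all the convex orders, and fine partitions give convergence in Wasserstein
distance. The proof follows this pattern, but it uses a martingale only between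
a finitely supported law and nu.

Averaging mu over cells gives mu' = sum_i a_i delta_(x_i), below mu and hence
below nu. The role of the conditional laws of Y is played by a splitting
of nu: set functions w_i >= 0 with sum_i w_i = nu, where w_i has mass a_i and
barycentre x_i. Averaging each w_i over the cells of a partition gives nu'.
Then mu' <= nu' and nu' <= nu by Jensen (jensen_discrete, quantized_le_convex),
and nu' is transported to nu at small cost by moving mass inside each cell
only (quantized_wasserstein).

The splitting exists because of the convex order (a theorem of Strassen). Up to
an error it is found by separation (exists_approximate_splitting): once nu is
discretized, the families of pairs (mass, mass times barycentre) of all
splittings form a convex set. If (a_i, a_i x_i)_i were far from it, then
Hahn-Banach (seminorm_separation) would give a separating functional, that is,
a finite family of affine functions g_i, and the Lipschitz convex function
max_i g_i would have a larger integral under mu' than under nu. An exact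
splitting is a limit of approximate ones (exists_exact_splitting). It is enough
to take limits of the numbers w_i(A) along an ultrafilter: the limits are
finitely additive and dominated by nu, and this domination makes barycentres
uniform limits of finite sums (cell_sum_dist), so that they pass to the limit.

Barycentres are never written as vector-valued integrals: they are limits of
the finite sums cell_sum along quantizers, which are measurable maps with
finitely many values that are close to the identity in L^1(nu) and L^p(nu)
(exists_quantizer). This is where separability of B and the finite moment of
order p are used. *)

(** * Hahn-Banach and separation of a convex set from the origin *)

Section hahn_banach.
Context {R : realType} {E : lmodType R}.
Implicit Types (p q : E -> R) (u v : E).

Definition sublinear p :=
  (forall u v, p (u + v) <= p u + p v) /\
  (forall (t : R) u, 0 < t -> p (t *: u) = t * p u).

Lemma sublinear0 p : sublinear p -> p 0 = 0.
Proof.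
by move=> [_ pZ]; have := pZ 2 0 (ltr0n _ 2); rewrite scaler0; lra.
Qed.

Lemma sublinearN p u : sublinear p -> - p (- u) <= p u.
Proof.
move=> sp; rewrite lerNl -subr_ge0 opprK addrC.
by rewrite -(sublinear0 sp) -[X in p X <= _](subrr u); exact: sp.1.
Qed.

Lemma sublinearZ p (t : R) u : sublinear p -> 0 <= t -> p (t *: u) = t * p u.
Proof.
move=> sp; rewrite le_eqVlt => /predU1P[<-|]; last exact: sp.2.
by rewrite scale0r mul0r sublinear0.
Qed.

Lemma inf_le_mem (A : set R) (m x : R) : (forall y, A y -> m <= y) -> A x ->
  inf A <= x.
Proof. by move=> Am Ax; apply: ge_inf => //; exists m => y; exact: Am. Qed.

Lemma inf_ge_lbound (A : set R) (m : R) : (forall y, A y -> m <= y) -> A !=set0 ->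
  m <= inf A.
Proof. by move=> Am A0; apply: lb_le_inf => // y; exact: Am. Qed.

(** A sublinear q <= p satisfies q u >= - p (- u), so the infima are finite. *)
Lemma sublinear_chain_inf p (F : set (E -> R)) : F !=set0 ->
  (forall q, F q -> sublinear q /\ forall u, q u <= p u) ->
  (forall q r, F q -> F r -> (forall u, q u <= r u) \/ (forall u, r u <= q u)) ->
  let h u := inf [set q u | q in F] in
  [/\ sublinear h, forall u, h u <= p u & forall q u, F q -> h u <= q u].
Proof.
move=> [q0 Fq0] Fp Ftot h.
have lb u y : [set q u | q in F] y -> - p (- u) <= y.
  move=> [q Fq <-]; have [sq qp] := Fp q Fq.
  by apply: le_trans (sublinearN u sq); rewrite lerN2.
have hq q u : F q -> h u <= q u.
  by move=> Fq; apply: (inf_le_mem (lb u)); exists q.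
have hp u : h u <= p u by apply: le_trans (hq q0 u Fq0) _; exact: (Fp _ Fq0).2.
have F0 u : [set q u | q in F] !=set0 by exists (q0 u), q0.
split => //; split => [u v|t u t0].
  rewrite -lerBlDr; apply: inf_ge_lbound => // _ [q Fq <-].
  rewrite lerBlDr -lerBlDl; apply: inf_ge_lbound => // _ [r Fr <-].
  rewrite lerBlDl.
  have [qr|rq] := Ftot q r Fq Fr.
    apply: (le_trans (hq q _ Fq)); apply: (le_trans ((Fp q Fq).1.1 _ _)).
    by rewrite lerD2l.
  apply: (le_trans (hq r _ Fr)); apply: (le_trans ((Fp r Fr).1.1 _ _)).
  by rewrite lerD2r.
apply/eqP; rewrite eq_le; apply/andP; split.
  rewrite -ler_pdivrMl//; apply: inf_ge_lbound => // _ [q Fq <-].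
  rewrite ler_pdivrMl// -(Fp q Fq).1.2//; exact: hq.
apply: inf_ge_lbound => // _ [q Fq <-].
by rewrite (Fp q Fq).1.2// ler_pM2l//; exact: hq.
Qed.

(** Zorn's lemma, for the reverse pointwise order. *)
Lemma sublinear_minimal p : sublinear p -> exists q,
  [/\ sublinear q, forall u, q u <= p u &
   forall r, sublinear r -> (forall u, r u <= q u) -> forall u, q u <= r u].
Proof.
move=> sp; pose T := {q : E -> R | sublinear q /\ forall u, q u <= p u}.
pose le (q r : T) := `[< forall u, sval r u <= sval q u >].
have [|||t tmin] := @ZL_preorder T (exist _ p (conj sp (fun u => lexx (p u)))) le.
- by move=> q; apply/asboolP.
- by move=> r s t /asboolP rs /asboolP st; apply/asboolP => u; exact: le_trans (rs u).
- move=> A Atot; have [A0|/set0P[a Aa]] := eqVneq A set0.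
    by exists (exist _ p (conj sp (fun u => lexx (p u)))) => s; rewrite A0.
  have [] := @sublinear_chain_inf p [set sval q | q in A].
  + by exists (sval a), a.
  + by move=> _ [q _ <-]; exact: (svalP q).
  + move=> _ _ [q Aq <-] [r Ar <-].
    by have [/asboolP|/asboolP] := Atot _ _ Aq Ar; [right|left].
  move=> sh hp hq.
  exists (exist (fun q => sublinear q /\ forall u, q u <= p u) _ (conj sh hp)).
  move=> s As; apply/asboolP => u.
  by apply: hq; exists s.
exists (sval t); have [st tp] := svalP t; split=> // r sr rt.
have rp u : r u <= p u by exact: le_trans (tp u).
by have /asboolP := tmin (exist _ r (conj sr rp)) (asboolT rt).
Qed.

(** The function w |-> inf_(t >= 0) (q (w + t v) - t q v) is sublinear and below
    q, so minimality makes it equal to q; at t = 1 this gives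
    q u + q v <= q (u + v). *)
Lemma minimal_sublinear_add q : sublinear q ->
  (forall r, sublinear r -> (forall u, r u <= q u) -> forall u, q u <= r u) ->
  forall u v, q (u + v) = q u + q v.
Proof.
move=> sq qmin u v; apply/eqP; rewrite eq_le sq.1/=.
pose A w := [set q (w + t *: v) - t * q v | t in [set t : R | 0 <= t]].
pose r w := inf (A w).
have lbA w y : A w y -> - q (- w) <= y.
  move=> [t /= t0 <-]; rewrite -(sublinearZ _ sq t0) lerBrDr addrC lerBlDr.
  by rewrite -{1}(addrK w (t *: v)) (addrC (t *: v)); exact: sq.1.
have A0 w : A w !=set0 by exists (q (w + 0 *: v) - 0 * q v), 0 => /=.
have rA w (t : R) : 0 <= t -> r w <= q (w + t *: v) - t * q v.
  by move=> t0; apply: (inf_le_mem (@lbA w)); exists t.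
have rq w : r w <= q w.
  by have := rA w 0 (lexx _); rewrite scale0r addr0 mul0r subr0.
suff sr : sublinear r.
  have := qmin r sr rq u; move=> /le_trans /(_ (rA u 1 ler01)).
  by rewrite scale1r mul1r lerBrDr.
split => [w z|t w t0].
  rewrite -lerBlDr; apply: inf_ge_lbound => // _ [t /= t0 <-].
  rewrite lerBlDr -lerBlDl; apply: inf_ge_lbound => // _ [s /= s0 <-].
  rewrite lerBlDl; apply: (le_trans (rA _ (t + s) (addr_ge0 t0 s0))).
  rewrite scalerDl mulrDl opprD addrACA (addrACA (q _)) lerD2r.
  by rewrite (le_trans (sq.1 _ _)).
apply/eqP; rewrite eq_le; apply/andP; split.
  rewrite -ler_pdivrMl//; apply: inf_ge_lbound => // _ [s /= s0 <-].
  rewrite ler_pdivrMl// mulrBr -(sq.2 t)// scalerDr scalerA mulrA.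
  by apply: rA; rewrite mulr_ge0// ltW.
apply: inf_ge_lbound => // _ [s /= s0 <-].
have -> : q (t *: w + s *: v) - s * q v =
    t * (q (w + (t^-1 * s) *: v) - t^-1 * s * q v).
  rewrite mulrBr -(sq.2 t)// scalerDr scalerA !mulrA mulfV ?gt_eqF// !mul1r.
  by [].
by rewrite ler_pM2l//; apply: rA; rewrite mulr_ge0// invr_ge0 ltW.
Qed.

(** The Hahn-Banach theorem: a minimal sublinear functional below p is linear. *)
Lemma linear_le_sublinear p : sublinear p ->
  exists phi : {scalar E}, forall u, phi u <= p u.
Proof.
move=> /sublinear_minimal[q [sq qp qmin]].
have qD := minimal_sublinear_add sq qmin.
have qN u : q (- u) = - q u.
  by apply/eqP; rewrite -addr_eq0 -qD addNr sublinear0.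
have qlin : scalar q.
  move=> t u v /=; rewrite qD; congr (_ + _).
  have [t0|t0] := leP 0 t; first exact: sublinearZ.
  by rewrite -[t *: u]opprK qN -scaleNr sq.2 ?oppr_gt0// mulNr opprK.
pose m := GRing.isLinear.Build _ _ _ _ q qlin.
pose phi : {scalar E} := HB.pack q m.
by exists phi.
Qed.

(** Hahn-Banach is applied to
    P v = inf { N (v - l c) - l delta | l >= 0, c in C },
    the largest sublinear functional with P <= N and P <= - delta on C. It does
    not take the value -oo since N >= delta on C gives P v >= - N v. *)
Lemma seminorm_separation (N : E -> R) (C : set E) (delta : R) :
  sublinear N -> (forall u, N (- u) = N u) -> C !=set0 ->
  (forall c c' (t : R), C c -> C c' -> 0 <= t <= 1 ->
     C (t *: c + (1 - t) *: c')) ->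
  (forall c, C c -> delta <= N c) -> 
  exists2 phi : {scalar E}, (forall u, phi u <= N u) &
    forall c, C c -> phi c <= - delta.
Proof.
move=> sN Neven [c0 Cc0] cvxC NC.
pose A v := [set y | exists l c, [/\ 0 <= l, C c & y = N (v - l *: c) - l * delta]].
have lbA v y : A v y -> - N v <= y.
  move=> [l [c [l0 Cc ->]]]; rewrite lerBrDr addrC lerBlDr.
  apply: (@le_trans _ _ (l * N c)); first exact: ler_wpM2l (NC _ Cc).
  rewrite -(sublinearZ _ sN l0) -Neven -(Neven v).
  rewrite {1}(_ : - (l *: c) = (v - l *: c) + (- v)); last first.
    by rewrite addrAC subrr add0r.
  exact: sN.1.
have A0 v : A v !=set0 by exists (N (v - 0 *: c0) - 0 * delta), 0, c0.
pose P v := inf (A v).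
have PA v l c : 0 <= l -> C c -> P v <= N (v - l *: c) - l * delta.
  by move=> l0 Cc; apply: (inf_le_mem (@lbA v)); exists l, c.
have sP : sublinear P.
  split => [u v|t u t0].
    rewrite -lerBlDr; apply: inf_ge_lbound => // _ [l [c [l0 Cc ->]]].
    rewrite lerBlDr -lerBlDl; apply: inf_ge_lbound => // _ [k [c' [k0 Cc' ->]]].
    rewrite lerBlDl.
    have [lk0|lk0] := eqVneq (l + k) 0.
      have {lk0}[l0' k0'] : l = 0 /\ k = 0.
        by move/eqP: lk0; rewrite paddr_eq0// => /andP[/eqP -> /eqP ->].
      rewrite l0' k0' !scale0r !mul0r !subr0.
      have := PA (u + v) 0 c (lexx _) Cc; rewrite scale0r mul0r !subr0 addrC.
      by move=> /le_trans; apply; rewrite addrC; exact: sN.1.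
    have lkp : 0 < l + k by rewrite lt0r lk0 addr_ge0.
    pose c2 := (l / (l + k)) *: c + (1 - l / (l + k)) *: c'.
    have Cc2 : C c2.
      apply: cvxC => //; apply/andP; split; first by rewrite divr_ge0// ltW.
      by rewrite ler_pdivrMr// mul1r lerDl.
    rewrite addrACA -opprD -mulrDl.
    apply: le_trans (PA (u + v) _ _ (ltW lkp) Cc2) _; rewrite lerD2r.
    suff -> : u + v - (l + k) *: c2 = (u - l *: c) + (v - k *: c') by exact: sN.1.
    rewrite [RHS]addrACA -opprD; congr (_ - _).
    rewrite /c2 scalerDr !scalerA mulrBr mulr1 mulrCA mulfV// mulr1.
    by rewrite [l + k]addrC addrK.
  apply/eqP; rewrite eq_le; apply/andP; split.
    rewrite -ler_pdivrMl//; apply: inf_ge_lbound => // _ [l [c [l0 Cc ->]]].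
    rewrite ler_pdivrMl// mulrBr -sN.2// scalerBr scalerA mulrA.
    by apply: PA => //; rewrite mulr_ge0// ltW.
  apply: inf_ge_lbound => // _ [l [c [l0 Cc ->]]].
  have -> : N (t *: u - l *: c) - l * delta =
      t * (N (u - (t^-1 * l) *: c) - t^-1 * l * delta).
    by rewrite mulrBr -sN.2// scalerBr scalerA !mulrA mulfV ?gt_eqF// !mul1r.
  by rewrite ler_pM2l//; apply: PA => //; rewrite mulr_ge0// invr_ge0 ltW.
have [phi phiP] := linear_le_sublinear sP; exists phi => [u|c Cc].
  have := PA u 0 c0 (lexx _) Cc0; rewrite scale0r mul0r !subr0.
  exact: le_trans.
apply: (le_trans (phiP c)).
have := PA c 1 c ler01 Cc.
by rewrite scale1r subrr mul1r (sublinear0 sN) sub0r.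
Qed.

End hahn_banach.

(** * Borel functions and finite mixtures of measures *)

Section borel_measurability.
Context {R : realType}.

(** Stated for a sigma-algebra given by generators, not for the Borel sets of a
    topological space, so that it applies to the Borel sets of B * B whatever
    the way the product is seen as a topological space. *)
Lemma measurable_fun_real_generated (T : pointedType) (G : set (set T))
    (f : T -> R) : (forall a b, G (f @^-1` `]a, b[%classic)) ->
  measurable_fun [set: g_sigma_algebraType G] (f : g_sigma_algebraType G -> R).
Proof.
move=> Gf; apply: (measurability _ (RGenOpens.measurableE R)).
by move=> _ [_ [a [b ->]] <-]; rewrite setTI; apply: sub_sigma_algebra.
Qed.

Lemma measurable_fun_generated (T U : pointedType) (G : set (set T))
    (H : set (set U)) (f : T -> U) : (forall A, H A -> G (f @^-1` A)) ->
  measurable_fun [set: g_sigma_algebraType G]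
    (f : g_sigma_algebraType G -> g_sigma_algebraType H).
Proof.
move=> Gf; apply: (@measurability _ _ (g_sigma_algebraType G)
  (g_sigma_algebraType H) _ _ H) => //.
by move=> _ [A HA <-]; rewrite setTI; apply: sub_sigma_algebra; exact: Gf.
Qed.

Lemma continuous_borel_measurable (T : ptopologicalType) (f : T -> R) :
  continuous f -> measurable_fun [set: borel T] (f : borel T -> R).
Proof.
move=> cf; apply: measurable_fun_real_generated => a b.
by apply: open_comp; [move=> x _; exact: cf|exact: interval_open].
Qed.

End borel_measurability.

Section finite_mixture.
Context {R : realType} d (X : measurableType d) (T : finType).
Variables (c : T -> R) (m : T -> {measure set X -> \bar R}).
Hypothesis c0 : forall t, 0 <= c t.

Let scaled t : {measure set X -> \bar R} := mscale (NngNum (c0 t)) (m t).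

Let ms (k : nat) : {measure set X -> \bar R} :=
  if insub k is Some o then scaled (enum_val (o : 'I_#|T|)) else mzero.

Let msE (o : 'I_#|T|) : ms o = scaled (enum_val o).
Proof. by rewrite /ms valK. Qed.

Let sum_ms (F : {measure set X -> \bar R} -> \bar R) :
  (\sum_(k < #|T|) F (ms k) = \sum_t F (scaled t))%E.
Proof.
by under eq_bigr do rewrite msE; rewrite -(big_enum_val (fun t => F (scaled t))).
Qed.

(** The integral formula comes with the construction because it is through
    integrals of nonnegative functions that mixtures are used. *)
Lemma exists_mixture : (\sum_t (c t)%:E * m t setT = 1)%E ->
  exists P : probability X R,
    (forall A, P A = \sum_t (c t)%:E * m t A)%E /\
    (forall f : X -> \bar R, (forall x, 0 <= f x)%E -> measurable_fun setT f ->
       \int[P]_x f x = \sum_t (c t)%:E * \int[m t]_x f x)%E.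
Proof.
move=> m1; pose M := msum ms #|T|.
have ME A : M A = (\sum_t (c t)%:E * m t A)%E.
  by rewrite /M /msum (sum_ms (fun m => m A)).
have M1 : M setT = 1%E by rewrite ME.
pose PM := Measure_isProbability.Build _ _ _ M M1.
pose P : probability X R := HB.pack M PM.
exists P; split => [|f f0 mf]; first exact: ME.
transitivity (\sum_(k < #|T|) \int[ms k]_x f x)%E.
  exact: (ge0_integral_measure_sum ms measurableT (fun x _ => f0 x) mf).
rewrite (sum_ms (fun m => (\int[m]_x f x)%E)); apply: eq_bigr => t _.
by rewrite /scaled ge0_integral_mscale.
Qed.

End finite_mixture.

(** * Finite Jensen inequality *)

Section jensen.
Context {R : realType} {V : lmodType R}.
Implicit Types f : V -> R.

Lemma sum_pair (W : nmodType) (I T : finType) (F : I * T -> W) :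
  \sum_k F k = \sum_i \sum_t F (i, t).
Proof. by rewrite pair_bigA; apply: eq_bigr => -[]. Qed.

(** Convexity with a plain real coefficient, more convenient for computations
    than a coefficient in an interval type. *)
Definition convex_fun f := forall (t : R) x y, 0 <= t <= 1 ->
  f (t *: x + (1 - t) *: y) <= t * f x + (1 - t) * f y.

Lemma convex_functionP (f : V -> R^o) :
  convex_function (setT : set (convex_lmodType V)) f <-> convex_fun f.
Proof.
split => [cf t x y /andP[t0 t1]|cf t x y _ _].
  by have := cf (Itv01 t0 t1) x y; rewrite !inE; apply.
apply: cf; apply/andP; split => //.
Qed.

(** Keeping a positive weight a apart makes all the denominators positive, so
    that the induction needs no case analysis on null weights. *)
Lemma convex_fun_seq f (I : Type) (s : seq I) (c : I -> R) (b : I -> V) a x :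
  convex_fun f -> (forall i, 0 <= c i) -> 0 < a ->
  (a + \sum_(i <- s) c i) *
    f ((a + \sum_(i <- s) c i)^-1 *: (a *: x + \sum_(i <- s) c i *: b i)) <=
  a * f x + \sum_(i <- s) c i * f (b i).
Proof.
move=> cf c0; elim: s a x => [|i s ih] a x a0.
  by rewrite !big_nil !addr0 scalerA mulVf ?gt_eqF// scale1r.
rewrite !big_cons !addrA.
have a'0 : 0 < a + c i by rewrite ltr_wpDr.
pose x' := (a + c i)^-1 *: (a *: x + c i *: b i).
have x'E : a *: x + c i *: b i = (a + c i) *: x'.
  by rewrite scalerA mulfV ?gt_eqF// scale1r.
rewrite x'E; apply: (le_trans (ih _ _ a'0)); rewrite lerD2r.
have -> : x' = (a / (a + c i)) *: x + (1 - a / (a + c i)) *: b i.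
  rewrite /x' scalerDr !scalerA mulrC; congr (_ + _ *: _).
  by field; rewrite gt_eqF.
have /cf : 0 <= a / (a + c i) <= 1.
  by rewrite divr_ge0 ?(ltW a0) ?(ltW a'0)//= ler_pdivrMr// mul1r lerDl.
move=> /(_ x (b i)); rewrite -(ler_pM2l a'0) => /le_trans; apply.
rewrite mulrDr !mulrA mulrBr mulr1 mulrCA mulfV ?gt_eqF// mulr1.
by rewrite addrAC subrr add0r (mulrAC (a + c i)) mulfV ?gt_eqF// mul1r.
Qed.

(** When all the weights vanish, both sides are 0, whatever the value of the
    inverse of 0. *)
Lemma jensen_fin f (T : finType) (c : T -> R) (b : T -> V) :
  convex_fun f -> (forall i, 0 <= c i) ->
  (\sum_i c i) * f ((\sum_i c i)^-1 *: (\sum_i c i *: b i)) <=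
  \sum_i c i * f (b i).
Proof.
move=> cf c0.
have [S0|] := eqVneq (\sum_i c i) 0.
  have c00 : forall i, c i = 0.
    move=> i; apply/eqP; move/eqP: S0.
    by rewrite psumr_eq0// => /allP /(_ i (mem_index_enum i)).
  rewrite S0 mul0r sumr_ge0// => i _; by rewrite c00 mul0r.
move=> S0; have [i ci] : exists i, 0 < c i.
  apply: contrapT => /forallNP h; move/eqP: S0; apply; apply: big1 => i _.
  by apply/eqP; rewrite eq_le c0 andbT leNgt; apply/negP.
have E (W : nmodType) (F : T -> W) : \sum_j F j =
    F i + \sum_(j <- [seq j <- index_enum T | j != i]) F j.
  by rewrite big_filter [LHS](bigD1 i).
rewrite (E _ c) (E _ (fun j => c j *: b j)) (E _ (fun j => c j * f (b j))).
exact: convex_fun_seq.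
Qed.

End jensen.

(** * Measurable partitions indexed by a finite type *)

Section finite_index.
Context {R : realType} d (X : measurableType d) (T : finType).
Variables (k : X -> T).
Hypothesis mk : forall t, measurable (k @^-1` [set t]).

Definition fin_additive (w : set X -> R) := forall A B, measurable A ->
  measurable B -> A `&` B = set0 -> w (A `|` B) = w A + w B.

Lemma fin_additive0 w : fin_additive w -> w set0 = 0.
Proof.
move=> aw; have := aw set0 set0 measurable0 measurable0 (set0I _).
by rewrite setU0; lra.
Qed.

Lemma measurable_index (Y : Type) (phi : T -> Y) (A : set Y) :
  measurable ((phi \o k) @^-1` A).
Proof.
have -> : (phi \o k) @^-1` A =
    \bigcup_(t in [set t | A (phi t)]) (k @^-1` [set t]).
  apply/seteqP; split => [x Ax|x [t At kx]]; first by exists (k x).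
  by rewrite /preimage/= /comp kx.
by apply: fin_bigcup_measurable.
Qed.

Lemma measurable_fun_index (phi : T -> R) : measurable_fun setT (phi \o k).
Proof. by move=> _ A _; rewrite setTI; exact: measurable_index. Qed.

Lemma measurable_fun_index_dep d' (Y : measurableType d') (f : T -> X -> Y) :
  (forall t, measurable_fun setT (f t)) ->
  measurable_fun setT (fun x => f (k x) x).
Proof.
move=> mf _ A mA; rewrite setTI.
have -> : (fun x => f (k x) x) @^-1` A =
    \bigcup_(t in [set: T]) (k @^-1` [set t] `&` f t @^-1` A).
  apply/seteqP; split => [x Ax|x [t _ [/= <-]]//]; by exists (k x).
apply: fin_bigcup_measurable => // t _; apply: measurableI => //.
by rewrite -[X in measurable X]setTI; exact: mf.
Qed.

Lemma cover_index : \big[setU/set0]_t (k @^-1` [set t]) = setT.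
Proof.
apply/seteqP; split => // x _; rewrite -bigcup_seq; exists (k x) => //=.
by rewrite mem_index_enum.
Qed.

Lemma trivIset_index (D : set T) : trivIset D (fun t => k @^-1` [set t]).
Proof. by move=> s t _ _ [x [<- <-]]. Qed.

Lemma fin_additive_index w A : fin_additive w -> measurable A ->
  w A = \sum_t w (A `&` k @^-1` [set t]).
Proof.
move=> aw mA.
suff H (s : seq T) : uniq s ->
    w (A `&` k @^-1` [set t | t \in s]) = \sum_(t <- s) w (A `&` k @^-1` [set t]).
  rewrite -H ?index_enum_uniq//; congr w; apply/seteqP; split => [x Ax|x []//].
  by split => //=; rewrite mem_index_enum.
elim: s => [|t s ih] /=.
  rewrite big_nil => _; rewrite -(fin_additive0 aw); congr w.
  by apply/seteqP; split => x //= [].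
move=> /andP[ts us]; rewrite big_cons -ih// -aw.
- congr w; rewrite -setIUr; congr (_ `&` _); apply/seteqP; split => x /=.
    by rewrite inE => /predU1P[->|]; [left|right].
  by move=> [->|xs]; rewrite inE ?eqxx ?xs ?orbT.
- exact: measurableI.
- by apply: measurableI => //; exact: (measurable_index id).
- apply/seteqP; split => x //= [[_ kx] [_]]; rewrite kx => ts'.
  by rewrite ts' in ts.
Qed.

Lemma ge0_integral_index (mu : {measure set X -> \bar R}) (f : X -> \bar R) :
  (forall x, 0 <= f x)%E -> measurable_fun setT f ->
  (\int[mu]_x f x = \sum_t \int[mu]_(x in k @^-1` [set t]) f x)%E.
Proof.
move=> f0 mf; rewrite -[in LHS]cover_index ge0_integral_bigsetU//.
- exact: index_enum_uniq.
- exact: trivIset_index.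
- by rewrite cover_index.
Qed.

Lemma integral_index (mu : probability X R) (phi : T -> R) :
  (\int[mu]_x (phi (k x))%:E =
   (\sum_t fine (mu (k @^-1` [set t])) * phi t)%:E)%E.
Proof.
have := @integral_bigsetU_EFin _ X R mu T (fun t => k @^-1` [set t]) (phi \o k)
  (index_enum T) mk (index_enum_uniq _) (@trivIset_index _).
rewrite cover_index => /= ->; last first.
  by apply/measurable_EFinP; exact: measurable_fun_index.
rewrite -sumEFin; apply: eq_bigr => t _.
rewrite (eq_integral (cst (phi t)%:E)); last by move=> x; rewrite inE/= => ->.
by rewrite integral_cst// EFinM fineK ?fin_num_measure// muleC.
Qed.

Lemma fin_additive_measure (mu : probability X R) :
  fin_additive (fun A => fine (mu A)).
Proof.
move=> A B mA mB AB; rewrite measureU// fineD// fin_num_measure//.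
Qed.

End finite_index.

(** * The p-th power of the distance *)

Section power.
Context {R : realType}.
Variables (p : R) (p1 : 1 <= p).

(** A crude bound, through (2 max (x, y))^p; the value of the constant does not
    matter. *)
Lemma powR_addM (x y : R) : 0 <= x -> 0 <= y ->
  (x + y) `^ p <= 2 `^ p * (x `^ p + y `^ p).
Proof.
move=> x0 y0; have p0 : 0 <= p by exact: le_trans p1.
pose z := Num.max x y.
have z0 : 0 <= z by rewrite le_max x0.
apply: (@le_trans _ _ ((2 * z) `^ p)).
  apply: ge0_ler_powR; rewrite ?nnegrE ?addr_ge0 ?mulr_ge0//.
  by rewrite mulr_natl mulr2n lerD// le_max lexx ?orbT.
rewrite powRM// ler_wpM2l ?powR_ge0// /z.
by case: (leP x y) => _; rewrite ?lerDl ?lerDr powR_ge0.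
Qed.

Lemma powR_le_self (x : R) : 0 <= x <= 1 -> x `^ p <= x.
Proof.
move=> /andP[]; rewrite le_eqVlt => /predU1P[<- _|x0 x1].
  by rewrite powR0// gt_eqF// (lt_le_trans _ p1).
by apply: ge1r_powR => //; rewrite x0.
Qed.

Lemma le_1DpowR (x : R) : 0 <= x -> x <= 1 + x `^ p.
Proof.
move=> x0; have [x1|x1] := leP x 1.
  by rewrite (le_trans x1)// lerDl powR_ge0.
by rewrite (le_trans (le1r_powR (ltW x1) p1))// lerDr.
Qed.

Lemma continuous_powR_norm {V : normedModType R} (d : V) :
  continuous (fun x : V => `|x - d| `^ p).
Proof.
move=> x; have cn : continuous (fun y : V => `|y - d|).
  move=> y; apply: (@continuous_comp _ _ _ (fun y => y - d) (fun y => `|y|)).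
    by apply: cvgB; [exact: cvg_id|exact: cvg_cst].
  exact: norm_continuous.
have [xd|xd] := eqVneq `|x - d| 0.
  rewrite /continuous_at xd powR0 ?gt_eqF ?(lt_le_trans _ p1)//.
  have := cn x; rewrite /continuous_at xd => cx.
  apply: (squeeze_cvgr _ (cvg_cst 0) cx).
  move/cvgr0Pnorm_lt : cx => /(_ 1 ltr01); apply: filterS => y /=.
  rewrite normr_id => y1; rewrite powR_ge0 powR_le_self//.
  by rewrite normr_ge0 ltW.
apply: (@continuous_comp _ _ _ (fun y : V => `|y - d|) (fun t : R => t `^ p)).
  exact: cn.
apply: differentiable_continuous; apply/derivable1_diffP.
apply: derivable_powR; rewrite in_itv/= andbT lt0r xd/=; exact: normr_ge0.
Qed.

End power.

(** * Quantizers *)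

Section quantizers.
Context {R : realType} {B : completeNormedModType R}.

(** The partition into cells is kept along with the map qpoint \o qcell: it may be
    finer than the partition into level sets of this map. *)
Record quantizer := Quantizer {
  qindex : finType ;
  qcell : B -> qindex ;
  qpoint : qindex -> B ;
  measurable_qcell :
    forall t, measurable (qcell @^-1` [set t] : set (borel B)) }.

Definition qerr (q : quantizer) (y : B) : R := `|qpoint (qcell q y) - y|.

Lemma measurable_dist (d : B) : measurable_fun [set: borel B]
  (fun y : borel B => `|d - y| : R).
Proof.
apply: continuous_borel_measurable => y.
apply: (@continuous_comp _ _ _ (fun y : B => d - y) (fun y => `|y|)).
  by apply: cvgB; [exact: cvg_cst|exact: cvg_id].
exact: norm_continuous.
Qed.

Lemma measurable_qerr q : measurable_fun [set: borel B] (qerr q).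
Proof.
apply: (measurable_fun_index_dep (measurable_qcell (q := q))
  (f := fun t y => `|qpoint t - y|)).
by move=> t; exact: measurable_dist.
Qed.

Lemma separable_sequence : separable B ->
  exists e : nat -> B, forall y d, 0 < d -> exists n, `|y - e n| < d.
Proof.
move=> [D /countable_injP[f finj] dD].
pose e n := xget 0 [set x | D x /\ f x = n].
exists e => y d d0.
have [] := dD (ball y d); [by exists y; exact: ballxx|exact: ball_open|].
move=> x [yx Dx]; exists (f x); rewrite /e.
case: xgetP => [z _ [Dz fz]|/(_ x)]; last by move=> [].
by rewrite (finj _ _ _ _ fz) ?inE//; move: yx; rewrite -ball_normE.
Qed.

(** The cells of the quantizers are sets of this form. *)
Lemma measurable_find (P : nat -> B -> bool) (s : seq nat) n :
  (forall j, measurable ([set y | P j y] : set (borel B))) ->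
  measurable ([set y | find (P ^~ y) s = n] : set (borel B)).
Proof.
move=> mP; elim: s n => [|j s ih] n /=.
  have [->|n0] := eqVneq n 0%N.
    by rewrite (_ : [set _ | _] = setT)//; apply/seteqP; split.
  rewrite (_ : [set _ | _] = set0)//; apply/seteqP; split => // y /= n0'.
  by rewrite -n0' in n0.
have -> : [set y | (if P j y then 0%N else (find (P^~ y) s).+1) = n] =
    ([set y | P j y] `&` [set y | 0%N = n]) `|`
    (~` [set y | P j y] `&` [set y | (find (P^~ y) s).+1 = n]).
  apply/seteqP; split => y /=; first by case: ifPn => ? ?; [left|right; split => //; exact/negP].
  by move=> [[-> //]|[/negP/negbTE ->]].
apply: measurableU; apply: measurableI => //.
- have [n0|n0] := eqVneq 0%N n.
    by rewrite (_ : [set _ | _] = setT)//; apply/seteqP; split.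
  by rewrite (_ : [set _ | _] = set0)//; apply/seteqP; split => // y /eqP; rewrite (negbTE n0).
- exact: measurableC.
- case: n => [|n]; first by rewrite (_ : [set _ | _] = set0)//; apply/seteqP; split.
  rewrite (_ : [set _ | _] = [set y | find (P^~ y) s = n])//; apply/seteqP.
  by split => y /=; [case|move=> ->].
Qed.

(** A point goes to the first of N terms of a dense sequence that is r-close to
    it, and to 0 if there is none. On the remaining set T the error is the norm
    of the point, and both this norm and its p-th power are at most
    g = 1 + `|y|^p, whose integral over T vanishes as N grows. *)
Lemma exists_quantizer (nu : probability (borel B) R) (p : R) (e : R) :
  separable B -> 1 <= p -> wasserstein_space p nu -> 0 < e ->
  exists q : quantizer,
    (\int[nu]_y (qerr q y `^ p)%:E <= e%:E)%E /\
    (\int[nu]_y (qerr q y)%:E <= e%:E)%E.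
Proof.
move=> /separable_sequence[c cdense] p1 nup e0.
(* r <= 1 makes r^p <= r, and the two errors add up to r + r <= e. *)
pose r := Num.min 1 (e / 2).
have r0 : 0 < r by rewrite lt_min ltr01 divr_gt0.
have r1 : r <= 1 by rewrite ge_min lexx.
have re : r + r <= e.
  have : r <= e / 2 by rewrite ge_min lexx orbT.
  lra.
pose P j y := `|y - c j| < r.
have mP j : measurable ([set y | P j y] : set (borel B)).
  apply: sub_sigma_algebra.
  rewrite (_ : [set _ | _] = ball (c j) r); first exact: ball_open.
  by rewrite -ball_normE; apply/seteqP; split => y; rewrite /P/= distrC.
pose F N y := find (P^~ y) (iota 0 N).
pose T N : set (borel B) := [set y | F N y = N].
have mT N : measurable (T N) by exact: measurable_find.
pose g y := 1 + `|y : B| `^ p.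
have mnp : measurable_fun [set: borel B] (fun y => `|y : B| `^ p).
  apply: (measurableT_comp (measurable_powR p)).
  by apply: continuous_borel_measurable; exact: norm_continuous.
have mg : measurable_fun [set: borel B] (g : borel B -> R).
  by apply: measurable_funD.
have g0 y : 0 <= g y by rewrite addr_ge0// powR_ge0.
have ig : nu.-integrable setT (EFin \o (g : borel B -> R)).
  apply/integrableP; split; first exact/measurable_EFinP.
  under eq_integral do rewrite /= ger0_norm// /g EFinD.
  rewrite ge0_integralD//; last exact/measurable_EFinP.
  apply: lte_add_pinfty; last exact: nup.
  rewrite (_ : (\int[nu]__ 1 = 1 * nu setT)%E); last exact: integral_cst.
  by rewrite mul1e (probability_setT nu) ltry.
have [N TN] : exists N, (\int[nu]_y ((EFin \o g) \_ (T N)) y <= r%:E)%E.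
  suff : (\int[nu]_y ((EFin \o g) \_ (T n)) y)%E @[n --> \oo] --> 0%E.
    move=> /fine_cvgP[fin /cvgr0Pnorm_lt/(_ r r0) small].
    have [N _ h] := filterI fin small; exists N.
    have [fN sN] := h N (leqnn N).
    by rewrite -(fineK fN) lee_fin; exact: le_trans (ler_norm _) (ltW sN).
  rewrite -(integral0 nu setT).
  apply: (@dominated_cvg _ _ _ nu setT measurableT
    (fun N => (EFin \o g) \_ (T N)) (cst 0%E) (EFin \o g)) => //.
  - move=> n; apply/measurable_restrict => //.
    by apply: measurable_funTS; exact/measurable_EFinP.
  - move=> y _; have [n yn] := cdense y r r0.
    apply: cvg_near_cst; exists n.+1 => // m /= nm.
    rewrite patchE memNset// /T/= /F => Fm.
    suff : (find (P^~ y) (iota 0 m) < size (iota 0 m))%N.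
      by rewrite Fm size_iota ltnn.
    rewrite -has_find; apply/hasP; exists n => //.
    by rewrite mem_iota.
  - move=> n y _; rewrite patchE; case: ifPn => _.
      by rewrite /= ger0_norm.
    by rewrite abse0 lee_fin.
have Fle y : (F N y < N.+1)%N.
  by rewrite ltnS -[X in (_ <= X)%N](size_iota 0 N) find_size.
have mcell (t : 'I_N.+1) :
    measurable ((fun y => Ordinal (Fle y)) @^-1` [set t] : set (borel B)).
  rewrite (_ : _ @^-1` _ = [set y | F N y = t]); first exact: measurable_find.
  apply/seteqP; split => y /= h; first by rewrite -h.
  by apply: val_inj.
pose q := @Quantizer 'I_N.+1 (fun y => Ordinal (Fle y))
  (fun t => if (t < N)%N then c t else 0) mcell.
have qT y : T N y -> qerr q y = `|y|.
  by rewrite /T/= /qerr/= => ->; rewrite ltnn sub0r normrN.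
have qNT y : ~ T N y -> qerr q y <= r.
  move=> yT; rewrite /qerr/=; have FN : (F N y < N)%N.
    by rewrite ltn_neqAle -ltnS Fle andbT; exact/eqP.
  rewrite FN distrC; apply: ltW.
  have hs : has (P^~ y) (iota 0 N) by rewrite has_find size_iota.
  by have := nth_find 0%N hs; rewrite nth_iota ?add0n//.
have gT0 y : 0 <= (g \_ (T N)) y by rewrite patchE; case: ifPn.
have key (h : B -> R) : measurable_fun [set: borel B] (h : borel B -> R) ->
    (forall y, 0 <= h y) ->
    (forall y, T N y -> h y <= g y) -> (forall y, ~ T N y -> h y <= r) ->
    (\int[nu]_y (h y)%:E <= e%:E)%E.
  move=> mh h0 hT hNT.
  apply: (@le_trans _ _ (\int[nu]_y (r%:E + ((EFin \o g) \_ (T N)) y))%E).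
    apply: ge0_le_integral => //.
    - by move=> y _; rewrite lee_fin.
    - exact/measurable_EFinP.
    - apply: emeasurable_funD => //; apply/measurable_restrict => //.
      by apply: measurable_funTS; exact/measurable_EFinP.
    - move=> y _; rewrite patchE; case: ifPn => [|yT].
        by rewrite inE => yT /=; rewrite -EFinD lee_fin ler_wpDl ?hT// ltW.
      by rewrite adde0 lee_fin; apply: hNT; rewrite notin_setE in yT.
  rewrite ge0_integralD//.
  - rewrite (_ : (\int[nu]__ r%:E = r%:E * nu setT)%E); last first.
      exact: integral_cst.
    rewrite (probability_setT nu) mule1.
    apply: (@le_trans _ _ (r%:E + r%:E)%E); first exact: leeD2l.
    by rewrite -EFinD lee_fin.
  - by move=> y _; rewrite lee_fin ltW.
  - by move=> y _; rewrite patchE; case: ifPn => // _; rewrite lee_fin.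
  - apply/measurable_restrict => //.
    by apply: measurable_funTS; exact/measurable_EFinP.
exists q; split; apply: key.
- by apply: (measurableT_comp (measurable_powR p)); exact: measurable_qerr.
- by move=> y; rewrite powR_ge0.
- by move=> y /qT ->; rewrite /g lerDr.
- move=> y /qNT h; apply: (le_trans _ h); apply: powR_le_self => //.
  by rewrite (le_trans h r1) andbT; exact: normr_ge0.
- exact: measurable_qerr.
- by move=> y; exact: normr_ge0.
- by move=> y /qT ->; exact: le_1DpowR.
- by move=> y /qNT.
Qed.

End quantizers.

(** * Integrals of Lipschitz functions along quantizers *)

Section mass.
Context {R : realType} {B : completeNormedModType R}.
Variable nu : probability (borel B) R.

Definition mass (A : set (borel B)) : R := fine (nu A).

Lemma mass_ge0 A : 0 <= mass A. Proof. exact: fine_ge0. Qed.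

Lemma mass_le1 A : measurable A -> mass A <= 1.
Proof.
move=> mA; rewrite -lee_fin fineK ?fin_num_measure//; exact: probability_le1.
Qed.

Lemma fin_additive_mass : fin_additive mass.
Proof. exact: fin_additive_measure. Qed.

End mass.

Section lipschitz_integrals.
Context {R : realType} {B : completeNormedModType R}.
Implicit Types f g : B -> R.

Definition lipschitz_le (L : R) f := forall x y, `|f x - f y| <= L * `|x - y|.

Lemma lipschitz_leP (f : B -> R^o) :
  lipschitz f -> exists2 L : R, 0 <= L & lipschitz_le L f.
Proof.
move=> /pinfty_ex_gt0[L L0 Lf]; exists L; first exact: ltW.
by move=> x y; exact: (Lf (x, y)).
Qed.

Lemma lipschitz_le_lipschitz (L : R) (f : B -> R^o) :
  lipschitz_le L f -> lipschitz f.
Proof.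
move=> Lf; apply: (@klipschitzW _ _ _ L).
  exact: (@globally_properfilter _ _ (0, 0)).
by move=> [x y] _; exact: Lf.
Qed.

Lemma lipschitz_le_continuous L f : lipschitz_le L f -> continuous f.
Proof.
move=> Lf; have Lf' : lipschitz (f : B -> R^o).
  exact: (lipschitz_le_lipschitz Lf).
have [k k0 kf] := lipschitz_leP Lf'.
move=> x; apply/cvgrPdist_le => e e0.
have k1 : 0 < k + 1 by rewrite ltr_wpDl.
near=> y; apply: (le_trans (kf x y)).
apply: (@le_trans _ _ ((k + 1) * `|x - y|)).
  by rewrite ler_wpM2r// lerDl.
rewrite -ler_pdivlMl// mulrC; near: y.
by apply: cvgr_dist_le; [exact: cvg_id|rewrite divr_gt0].
Unshelve. all: by end_near. Qed.

Variables (nu : probability (borel B) R) (p : R).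
Hypotheses (p1 : 1 <= p) (nup : wasserstein_space p nu).

(** A Lipschitz function grows at most linearly, and `|y| <= 1 + `|y|^p. *)
Lemma integrable_lipschitz L f : 0 <= L -> lipschitz_le L f ->
  nu.-integrable setT (EFin \o (f : borel B -> R)).
Proof.
move=> L0 Lf.
have mf : measurable_fun [set: borel B] (f : borel B -> R).
  by apply: continuous_borel_measurable; exact: lipschitz_le_continuous Lf.
have mn : measurable_fun [set: borel B] (fun y : borel B => (`|y : B| `^ p)).
  apply: (measurableT_comp (measurable_powR p)).
  by apply: continuous_borel_measurable; exact: norm_continuous.
have ip : nu.-integrable setT (EFin \o (fun y : borel B => (`|y : B| `^ p))).
  apply/integrableP; split; first exact/measurable_EFinP.
  by under eq_integral do rewrite /= ger0_norm ?powR_ge0//.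
have ic (k : R) : nu.-integrable setT (EFin \o cst k).
  by apply: finite_measure_integrable_cst.
have i1 := integrableD measurableT (ic (`|f 0| + L)) (integrableZl measurableT L ip).
apply: (le_integrable measurableT _ _ i1); first exact/measurable_EFinP.
move=> y _ /=; rewrite lee_fin [leRHS]ger0_norm; last first.
  by rewrite addr_ge0 ?addr_ge0// mulr_ge0// powR_ge0.
have := ler_normD (f y - f 0) (f 0); rewrite subrK.
have := Lf y 0; rewrite subr0.
have := ler_wpM2l L0 (le_1DpowR p1 (normr_ge0 (y : B))).
by rewrite mulrDr mulr1; lra.
Qed.

Lemma integrable_qerr (q : quantizer) (eta : R) :
  (\int[nu]_y (qerr q y)%:E <= eta%:E)%E ->
  nu.-integrable setT (EFin \o (qerr q : borel B -> R)).
Proof.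
move=> qeta; apply/integrableP; split.
  by apply/measurable_EFinP; exact: measurable_qerr.
have E y : `|qerr q y| = qerr q y by rewrite /qerr normr_id.
under eq_integral do rewrite /= E.
exact: le_lt_trans qeta (ltry _).
Qed.

Definition qmass (q : quantizer) (t : qindex q) : R :=
  mass nu (qcell q @^-1` [set t]).

Lemma lipschitz_quantizer L f (q : quantizer) (eta : R) : 0 <= L ->
  lipschitz_le L f -> (\int[nu]_y (qerr q y)%:E <= eta%:E)%E ->
  `|\sum_(t : qindex q) qmass t * f (qpoint t) - \int[nu]_y f y| <= L * eta.
Proof.
move=> L0 Lf qeta.
pose fq (y : borel B) := f (qpoint (qcell q y)).
have fqE : \int[nu]_y fq y = \sum_(t : qindex q) qmass t * f (qpoint t).
  rewrite /Rintegral.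
  by rewrite (integral_index (@measurable_qcell _ _ q) nu (fun t => f (qpoint t))).
have iq := integrable_qerr qeta.
have if_ := integrable_lipschitz L0 Lf.
have mfq : measurable_fun [set: borel B] fq.
  exact: (measurable_fun_index (@measurable_qcell _ _ q) (fun t => f (qpoint t))).
have iLq : nu.-integrable setT (EFin \o (fun y : borel B => L * qerr q y)).
  exact: (integrableZl measurableT L iq).
have le y : `|fq y - f y| <= L * qerr q y by exact: Lf.
have ifq : nu.-integrable setT (EFin \o fq).
  have i2 := integrableD measurableT (integrable_abse if_) iLq.
  apply: (le_integrable measurableT _ _ i2); first exact/measurable_EFinP.
  move=> y _ /=; rewrite lee_fin [leRHS]ger0_norm; last first.
    by rewrite addr_ge0// mulr_ge0//; exact: normr_ge0.
  have := ler_normD (fq y - f y) (f y); rewrite subrK.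
  by have := le y; lra.
rewrite -fqE -RintegralB//.
apply: (le_trans (le_normr_Rintegral measurableT _)).
  exact: (integrableB measurableT ifq if_).
apply: (@le_trans _ _ (\int[nu]_y (L * qerr q y))).
  apply: le_Rintegral => //.
  have := integrable_abse (integrableB measurableT ifq if_).
  by apply: eq_integrable.
rewrite RintegralZl// ler_wpM2l// /Rintegral.
rewrite -lee_fin fineK//.
exact: (integrable_fin_num measurableT iq).
Qed.

End lipschitz_integrals.

(** * Approximate splittings, by separation *)

Section approximate_splitting.
Context {R : realType} {B : completeNormedModType R}.
Variables (nu : probability (borel B) R) (p : R).
Hypotheses (p1 : 1 <= p) (nup : wasserstein_space p nu).
Variables (I : finType) (a : I -> R) (x : I -> B).
Hypotheses (a0 : forall i, 0 <= a i) (a1 : \sum_i a i = 1).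
Hypothesis ax_nu : forall f, lipschitz_le 1 f -> convex_fun f ->
  \sum_i a i * f (x i) <= \int[nu]_y f y.
Variables (q : @quantizer R B) (eta : R).
Hypothesis qeta : (\int[nu]_y (qerr q y)%:E <= eta%:E)%E.

Let P : lmodType R := (R^o * B)%type.
Let n (w : P) : R := `|w.1 : R| + `|w.2|.
Let N (u : I -> P) : R := \sum_i n (u i).
Let v (t : qindex q) : P := qmass nu t *: ((1, qpoint t) : P).
Let target i : P := a i *: ((1, x i) : P).
Let F (c : I -> qindex q -> R) : I -> P :=
  fun i => \sum_t c i t *: v t - target i.
Let splitting (c : I -> qindex q -> R) :=
  (forall i t, 0 <= c i t) /\ (forall t, \sum_i c i t = 1).

Let nD w z : n (w + z) <= n w + n z.
Proof.
by rewrite /n addrACA lerD// ler_normD.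
Qed.

Let nZ (t : R) w : n (t *: w) = `|t| * n w.
Proof. by rewrite /n /= normrM normrZ mulrDr. Qed.

Let sublinear_N : sublinear N.
Proof.
split => [u w|t u t0]; rewrite /N.
  by rewrite -big_split; apply: ler_sum => i _; exact: nD.
by rewrite mulr_sumr; apply: eq_bigr => i _; rewrite nZ gtr0_norm.
Qed.

(** A splitting of the discretized nu is a matrix c : c i t is the share of the
    cell t given to i. The vector F c records, for each i, the differences
    between the mass and first moment of the i-th piece and their targets. If
    every F c had norm at least eta + e, a separating functional phi would
    satisfy phi (F c) <= - (eta + e). Restricted to the i-th component, phi is a
    1-Lipschitz affine function g_i, and phi (F c) is the difference
    between sum_(i, t) c i t mass(t) g_i(point t) and sum_i a_i g_i(x_i). Giving
    each cell to the index that maximizes g_i at its point turns the first sum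
    into the integral of max_i g_i up to eta, which is a contradiction. *)
Lemma exists_approximate_splitting (e : R) : 0 < e ->
  exists c : I -> qindex q -> R, splitting c /\
    forall i, `|\sum_t c i t * qmass nu t - a i| <= eta + e /\
      `|\sum_t (c i t * qmass nu t) *: qpoint t - a i *: x i| <= eta + e.
Proof.
move=> e0.
have [i0 _] : exists i : I, True.
  apply: contrapT => /forallNP noI; move: a1; rewrite big1 => [/esym/eqP|i _].
    by rewrite oner_eq0.
  by have := noI i; case.
have [[c [sc Fc]]|far] := pselect (exists c, splitting c /\ N (F c) < eta + e).
  exists c; split => // i.
  have ni : n (F c i) <= eta + e.
    apply: le_trans (ltW Fc); rewrite /N (bigD1 i)//= lerDl sumr_ge0// => j _.
    by rewrite addr_ge0.
  have F1 : (F c i).1 = \sum_t c i t * qmass nu t - a i.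
    rewrite -[LHS]/((\sum_t c i t *: v t).1 - a i * 1) mulr1 raddf_sum/=.
    congr (_ - _); apply: eq_bigr => t _.
    by rewrite -[LHS]/(c i t * (qmass nu t * 1)) mulr1.
  have F2 : (F c i).2 = \sum_t (c i t * qmass nu t) *: qpoint t - a i *: x i.
    rewrite -[LHS]/((\sum_t c i t *: v t).2 - a i *: x i) raddf_sum/=.
    by congr (_ - _); apply: eq_bigr => t _; rewrite scalerA.
  rewrite -F1 -F2; split; apply: le_trans ni; rewrite /n.
    by rewrite lerDl.
  by rewrite lerDr.
have Nfar c : splitting c -> eta + e <= N (F c).
  move=> sc; rewrite leNgt; apply/negP => h; apply: far; by exists c.
have [||||phi phiN phiF] := @seminorm_separation R (I -> P) N
    [set F c | c in splitting] (eta + e) sublinear_N.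
- by move=> u; apply: eq_bigr => i _; rewrite -scaleN1r nZ normrN1 mul1r.
- exists (F (fun i _ => (i == i0)%:R)), (fun i _ => (i == i0)%:R) => //.
  split => // _; rewrite (bigD1 i0)//= eqxx big1 ?addr0// => i /negbTE -> //.
- move=> _ _ t [c [c0 c1] <-] [d [d0 d1] <-] /andP[t0 t1].
  exists (fun i s => t * c i s + (1 - t) * d i s).
    split => [i s|s]; first by rewrite addr_ge0// mulr_ge0// subr_ge0.
    by rewrite big_split/= -!mulr_sumr c1 d1 !mulr1 subrKC.
  apply/funext => i; rewrite /F.
  rewrite -[LHS]/(_ - _) -[RHS]/(t *: (_ - _) + (1 - t) *: (_ - _)).
  rewrite !scalerBr addrACA -opprD -scalerDl subrKC scale1r; congr (_ - _).
  rewrite !scaler_sumr -big_split; apply: eq_bigr => s _.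
  by rewrite scalerDl !scalerA.
- by move=> _ [c sc <-]; exact: Nfar.
pose single i (w : P) : I -> P := fun j => if j == i then w else 0.
have singleE (u : I -> P) : u = \sum_i single i (u i).
  apply/funext => j; rewrite fct_sumE (bigD1 j)//= /single eqxx.
  by rewrite big1 ?addr0// => i /negbTE; rewrite eq_sym => ->.
have singleD i w z : single i (w + z) = single i w + single i z.
  apply/funext => j; rewrite -[RHS]/(single i w j + single i z j) /single.
  by case: ifP; rewrite ?addr0.
have singleZ i (t : R) w : single i (t *: w) = t *: single i w.
  apply/funext => j; rewrite -[RHS]/(t *: single i w j) /single.
  by case: ifP; rewrite ?scaler0.
pose g i y := phi (single i (1, y)).
have phiv i t : phi (single i (v t)) = qmass nu t * g i (qpoint t).
  by rewrite singleZ linearZ.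
have phit i : phi (single i (target i)) = a i * g i (x i).
  by rewrite singleZ linearZ.
have singleB i w : single i (- w) = - single i w.
  by rewrite -scaleN1r singleZ scaleN1r.
have single_sum i (J : finType) (w : J -> P) :
    single i (\sum_t w t) = \sum_t single i (w t).
  apply: (big_morph (single i)) => [w1 w2|]; first exact: singleD.
  by apply/funext => j; rewrite /single; case: ifP.
have phiFE c : phi (F c) = \sum_i \sum_t c i t * (qmass nu t * g i (qpoint t)) -
    \sum_i a i * g i (x i).
  rewrite [F c]singleE linear_sum -sumrB; apply: eq_bigr => i _.
  rewrite /F singleD singleB linearB phit; congr (_ - _).
  rewrite single_sum linear_sum; apply: eq_bigr => t _.
  by rewrite singleZ linearZ/= phiv.
have gcvx i (t : R) y z : g i (t *: y + (1 - t) *: z) = t * g i y + (1 - t) * g i z.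
  rewrite /g -[(1, _)]/((1, t *: y + (1 - t) *: z) : P).
  have -> : ((1, t *: y + (1 - t) *: z) : P) = t *: (1, y) + (1 - t) *: (1, z).
    by congr pair; rewrite -[RHS]/(t * 1 + (1 - t) * 1) !mulr1 subrKC.
  by rewrite singleD !singleZ linearD !linearZ.
have glip i y z : g i y <= g i z + `|y - z|.
  rewrite -lerBlDl /g -linearB -singleB -singleD.
  apply: (le_trans (phiN _)); rewrite /N (bigD1 i)//= big1 => [|j /negbTE ji].
    by rewrite addr0 /single eqxx /n/= subrr normr0 add0r.
  by rewrite /single ji /n !normr0 addr0.
(* f is the maximum of the g i. *)
pose am y := [arg max_(i > i0) g i y]%O.
pose f y := g (am y) y.
have gf i y : g i y <= f y.
  by rewrite /f /am; case: arg_maxP => // j _; apply.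
have flip1 y z : f y - f z <= `|y - z|.
  by rewrite lerBlDl (le_trans (glip _ y z))// lerD2r.
have flip : lipschitz_le 1 f.
  move=> y z; rewrite mul1r ler_norml flip1 andbT lerNl opprB distrC.
  exact: flip1.
have fcvx : convex_fun f.
  move=> t y z /andP[t0 t1]; rewrite {1}/f gcvx lerD// ler_wpM2l//.
  by rewrite subr_ge0.
(* each cell goes entirely to an index where the maximum at its point is reached *)
pose c i (t : qindex q) : R := (i == am (qpoint t))%:R.
have sc : splitting c.
  split => [i t|t]; first by rewrite /c.
  rewrite (bigD1 (am (qpoint t)))//= /c eqxx big1 ?addr0// => i /negbTE ->//.
have := phiF _ (imageP F sc); rewrite phiFE exchange_big/=.
rewrite (eq_bigr (fun t => qmass nu t * f (qpoint t))); last first.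
  move=> t _; rewrite (bigD1 (am (qpoint t)))//= /c eqxx mul1r.
  by rewrite big1 ?addr0// => i /negbTE ->; rewrite mul0r.
have := lipschitz_quantizer p1 nup ler01 flip qeta.
rewrite mul1r ler_norml => /andP[h1 _].
have h2 := ax_nu flip fcvx.
have h3 : \sum_i a i * g i (x i) <= \sum_i a i * f (x i).
  by apply: ler_sum => i _; rewrite ler_wpM2l.
lra.
Qed.

End approximate_splitting.

(** * Splittings of a probability measure and finite barycentre sums *)

Section splittings.
Context {R : realType} {B : completeNormedModType R}.
Variable nu : probability (borel B) R.

(** A bound on a sum over the common refinement of two partitions, read as a
    bound on an integral. *)
Lemma integral_pair_cells (q q' : @quantizer R B)
    (phi : qindex q -> qindex q' -> R) (h : B -> R) (K : R) :
  measurable_fun [set: borel B] (h : borel B -> R) ->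
  (forall t s, 0 <= phi t s) ->
  (forall y, phi (qcell q y) (qcell q' y) <= h y) ->
  (\int[nu]_y (h y)%:E <= K%:E)%E ->
  \sum_t \sum_s mass nu (qcell q @^-1` [set t] `&` qcell q' @^-1` [set s]) * phi t s
    <= K.
Proof.
move=> mh phi0 phih hK.
pose k (y : borel B) := (qcell q y, qcell q' y).
have kE t : k @^-1` [set t] = qcell q @^-1` [set t.1] `&` qcell q' @^-1` [set t.2].
  apply/seteqP; split => y /=; first by move=> <-.
  by move: t => [t s] /= [<- <-].
have mk t : measurable (k @^-1` [set t]).
  by rewrite kE; apply: measurableI; exact: measurable_qcell.
rewrite pair_bigA/=.
rewrite (eq_bigr (fun t => fine (nu (k @^-1` [set t])) * phi t.1 t.2)); last first.
  by move=> t _; rewrite kE.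
rewrite -lee_fin -(integral_index mk nu (fun t => phi t.1 t.2)).
apply: le_trans hK; apply: ge0_le_integral => //.
- by move=> y _; rewrite lee_fin.
- apply/measurable_EFinP.
  exact: (measurable_fun_index mk (fun t => phi t.1 t.2)).
- exact/measurable_EFinP.
- by move=> y _; rewrite lee_fin; exact: phih.
Qed.

(** An approximation of the integral over A of the identity with respect to w. *)
Definition cell_sum (w : set (borel B) -> R) (A : set (borel B))
    (q : @quantizer R B) : B :=
  \sum_t w (A `&` qcell q @^-1` [set t]) *: qpoint t.

Lemma fin_additive_le (w : set (borel B) -> R) A C : fin_additive w ->
  (forall A, measurable A -> 0 <= w A) -> measurable A -> measurable C ->
  A `<=` C -> w A <= w C.
Proof.
move=> aw w0 mA mC AC; have -> : C = A `|` (C `\` A) by rewrite setDUK.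
rewrite aw//; [|exact: measurableD|by rewrite setDIK].
by rewrite lerDl w0//; exact: measurableD.
Qed.

(** Both sums are written over the common refinement of the two partitions; the
    bound is uniform in w because w <= nu. *)
Lemma cell_sum_dist w A (q q' : @quantizer R B) (eta eta' : R) :
  fin_additive w -> (forall A, measurable A -> 0 <= w A <= mass nu A) ->
  measurable A ->
  (\int[nu]_y (qerr q y)%:E <= eta%:E)%E ->
  (\int[nu]_y (qerr q' y)%:E <= eta'%:E)%E ->
  `|cell_sum w A q - cell_sum w A q'| <= eta + eta'.
Proof.
move=> aw w0 mA qeta qeta'.
have mc := @measurable_qcell _ _ q; have mc' := @measurable_qcell _ _ q'.
have -> : cell_sum w A q = \sum_t \sum_s
    w (A `&` qcell q @^-1` [set t] `&` qcell q' @^-1` [set s]) *: qpoint t.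
  apply: eq_bigr => t _; rewrite (fin_additive_index mc' aw).
    by rewrite scaler_suml.
  exact: measurableI.
have -> : cell_sum w A q' = \sum_t \sum_s
    w (A `&` qcell q @^-1` [set t] `&` qcell q' @^-1` [set s]) *: qpoint s.
  rewrite exchange_big; apply: eq_bigr => s _; rewrite (fin_additive_index mc aw).
    by rewrite scaler_suml; apply: eq_bigr => t _; rewrite setIAC.
  exact: measurableI.
rewrite -sumrB; apply: (le_trans (ler_norm_sum _ _ _)).
apply: (@le_trans _ _ (\sum_t \sum_s
    mass nu (qcell q @^-1` [set t] `&` qcell q' @^-1` [set s]) *
    `|qpoint t - qpoint s|)).
  apply: ler_sum => t _; rewrite -sumrB; apply: (le_trans (ler_norm_sum _ _ _)).
  apply: ler_sum => s _; rewrite -scalerBr normrZ ler_wpM2r//.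
  have mts : measurable (qcell q @^-1` [set t] `&` qcell q' @^-1` [set s] : set (borel B)).
    exact: measurableI.
  have mAts : measurable (A `&` qcell q @^-1` [set t] `&` qcell q' @^-1` [set s] : set (borel B)).
    by apply: measurableI => //; exact: measurableI.
  have /andP[w0' wm] := w0 _ mAts.
  rewrite ger0_norm//; apply: (le_trans wm).
  apply: fin_additive_le => //; first exact: (fin_additive_mass nu).
    by move=> *; exact: mass_ge0.
  by move=> y [[_ ?] ?]; split.
apply: (@integral_pair_cells _ _ _ (fun y => qerr q y + qerr q' y)) => //.
- by apply: measurable_funD; exact: measurable_qerr.
- move=> y; rewrite /qerr -{1}(subrK y (qpoint (qcell q y))) -addrA.
  by rewrite (le_trans (ler_normD _ _))// lerD2l distrC.
- under eq_integral do rewrite EFinD.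
  rewrite ge0_integralD//.
  + by rewrite EFinD leeD.
  + by move=> y _; rewrite lee_fin; exact: normr_ge0.
  + by apply/measurable_EFinP; exact: measurable_qerr.
  + by move=> y _; rewrite lee_fin; exact: normr_ge0.
  + by apply/measurable_EFinP; exact: measurable_qerr.
Qed.

(** The pieces are only asked to be finitely additive, which is preserved by
    limits along an ultrafilter; being dominated by nu, they are in fact
    measures. *)
Definition mass_splitting (I : finType) (w : I -> set (borel B) -> R) :=
  [/\ forall i, fin_additive (w i),
      forall i A, measurable A -> 0 <= w i A &
      forall A, measurable A -> \sum_i w i A = mass nu A].

Lemma mass_splitting_le (I : finType) (w : I -> set (borel B) -> R) i A :
  mass_splitting w -> measurable A -> 0 <= w i A <= mass nu A.
Proof.
move=> [_ w0 wm] mA; rewrite w0//= -wm// (bigD1 i)//= lerDl sumr_ge0// => j _.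
exact: w0.
Qed.

End splittings.

(** * Exact splittings, by compactness *)

Section ultralimits.

Lemma ultra_fmap (S T : Type) (F : set_system S) (u : S -> T) :
  UltraFilter F -> UltraFilter (u @ F).
Proof.
move=> FU; split; first exact: fmap_proper_filter.
move=> G PG FG; apply/seteqP; split => // A GA.
have [//|FnA] := in_ultra_setVsetC (u @^-1` A) FU.
have : G (A `&` ~` A) by apply: filterI => //; exact: FG.
by rewrite setICr => /filter_not_empty.
Qed.

(** Compactness of the segment [a, b], without extracting a subsequence: one
    ultrafilter serves all bounded sequences at once, here one sequence per
    index i and measurable set A. *)
Lemma ultra_cvg (R : realType) (F : set_system nat) (u : nat -> R) (a b : R) :
  UltraFilter F -> (forall n, a <= u n <= b) -> cvg (u @ F).
Proof.
move=> FU ab; have := @segment_compact R a b; rewrite compact_ultra.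
move=> /(_ (u @ F) (ultra_fmap u FU))[].
  by apply: (@filterE _ F) => n; rewrite /= in_itv/=; exact: ab.
by move=> l [_ ul]; apply/cvg_ex; exists l.
Qed.

Lemma cvg_fin_sum (R : realType) (V : normedModType R) (T : Type)
    (F : set_system T) (I : finType) (f : I -> T -> V) (l : I -> V) :
  Filter F -> (forall i, f i @ F --> l i) ->
  (fun n => \sum_i f i n) @ F --> \sum_i l i.
Proof.
move=> FF fl; elim: (index_enum I) => [|i s ih].
  by under eq_fun do rewrite big_nil; rewrite big_nil; exact: cvg_cst.
under eq_fun do rewrite big_cons.
by rewrite big_cons; apply: cvgD => //; exact: fl.
Qed.

End ultralimits.

Section exact_splitting.
Context {R : realType} {B : completeNormedModType R}.
Variables (nu : probability (borel B) R) (p : R).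
Hypotheses (p1 : 1 <= p) (nup : wasserstein_space p nu).
Variables (I : finType) (a : I -> R) (x : I -> B).
Hypotheses (a0 : forall i, 0 <= a i) (a1 : \sum_i a i = 1).
Hypothesis ax_nu : forall f, lipschitz_le 1 f -> convex_fun f ->
  \sum_i a i * f (x i) <= \int[nu]_y f y.
Variables (q : nat -> @quantizer R B) (eta : nat -> R).
Hypothesis eta_gt0 : forall n, 0 < eta n.
Hypothesis eta_cvg0 : eta @ \oo --> 0.
Hypothesis qeta : forall n, (\int[nu]_y (qerr (q n) y)%:E <= (eta n)%:E)%E.

(** For the n-th quantizer, an approximate splitting c gives the pieces
    A |-> sum_t c i t nu (A inter cell t), which have total sum nu. Their limits
    along an ultrafilter have the right barycentres since, for a fixed quantizer
    q m, cell_sum is a finite sum, hence continuous for pointwise convergence,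
    and for the n-th pieces it differs by at most eta m + eta n from the sum along
    q n, which is close to a_i x_i. *)
Lemma exists_exact_splitting : exists w : I -> set (borel B) -> R,
  [/\ mass_splitting nu w, forall i, w i setT = a i &
      forall i n, `|cell_sum (w i) setT (q n) - a i *: x i| <= eta n].
Proof.
pose cell n t := (qcell (q n) @^-1` [set t] : set (borel B)).
have mcell n t : measurable (cell n t) by exact: measurable_qcell.
pose exc n := cid (exists_approximate_splitting p1 nup a0 a1 ax_nu (qeta n)
  (eta_gt0 n)).
pose c n := projT1 (exc n); have cP n := projT2 (exc n); rewrite -/(c _) in cP.
pose wn n i A := \sum_t c n i t * mass nu (A `&` cell n t).
have awn n i : fin_additive (wn n i).
  move=> A C mA mC AC; rewrite /wn -big_split/=; apply: eq_bigr => t _.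
  rewrite -mulrDr; congr (_ * _); rewrite setIUl fin_additive_mass//.
  - exact: measurableI.
  - exact: measurableI.
  - by rewrite setIACA AC set0I.
have wn_ge0 n i A : 0 <= wn n i A.
  by apply: sumr_ge0 => t _; rewrite mulr_ge0 ?mass_ge0//; apply: (cP n).1.1.
have wn_sum n A : measurable A -> \sum_i wn n i A = mass nu A.
  move=> mA; rewrite exchange_big/=.
  rewrite (fin_additive_index (mcell n) (fin_additive_mass nu) mA).
  by apply: eq_bigr => t _; rewrite -mulr_suml (cP n).1.2 mul1r.
have wnS n : mass_splitting nu (wn n).
  by split; [exact: awn|move=> i A _; exact: wn_ge0|exact: wn_sum].
have wn_cell n i t : wn n i (setT `&` cell n t) = c n i t * qmass nu t.
  rewrite setTI /wn (bigD1 t)//= setIid big1 ?addr0// => s st.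
  rewrite (_ : _ `&` _ = set0) ?(fin_additive0 (fin_additive_mass nu)) ?mulr0//.
  by apply/seteqP; split => // y [/= ys yt]; move: st; rewrite -yt ys eqxx.
have wnT n i : `|wn n i setT - a i| <= eta n + eta n.
  have := ((cP n).2 i).1; congr (`|_ - _| <= _); apply: eq_bigr => t _.
  by rewrite setTI.
have wnx n i : `|cell_sum (wn n i) setT (q n) - a i *: x i| <= eta n + eta n.
  have := ((cP n).2 i).2; congr (`|_ - _| <= _); apply: eq_bigr => t _.
  by rewrite wn_cell.
have [G [GU Goo]] := @ultraFilterLemma nat \oo _.
have etaG : eta @ G --> 0 by move=> A /eta_cvg0 /Goo.
pose w i A := lim (wn n i A @[n --> G]).
have wcvg i A : measurable A -> wn n i A @[n --> G] --> w i A.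
  move=> mA; apply: (@ultra_cvg R G _ 0 1 GU) => n; rewrite wn_ge0/=.
  have /andP[_ h] := mass_splitting_le i (wnS n) mA.
  by rewrite (le_trans h)// mass_le1.
have lim_eq (u : nat -> R) (l l' : R) : u @ G --> l -> u @ G --> l' -> l = l'.
  by move=> h h'; exact: (norm_cvg_unique h h').
have wS : mass_splitting nu w.
  split => [i A C mA mC AC|i A mA|A mA].
  - apply: (lim_eq (fun n => wn n i (A `|` C))).
      by apply: wcvg; exact: measurableU.
    under eq_fun do rewrite awn//.
    by apply: cvgD; exact: wcvg.
  - by apply: (cvgr_to_ge (wcvg i A mA)); apply: nearW => n; exact: wn_ge0.
  - apply: (lim_eq (fun n => \sum_i wn n i A)).
      by apply: (@cvg_fin_sum R R^o) => i; exact: wcvg.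
    by under eq_fun do rewrite wn_sum//; exact: cvg_cst.
exists w; split => // [i|i m].
  apply: (lim_eq (fun n => wn n i setT)); first exact: wcvg.
  have e2 : (eta n + eta n) @[n --> G] --> 0.
    by rewrite -[X in _ --> X](addr0 0); exact: cvgD.
  apply/subr_cvg0; apply: (norm_cvg0 (f := fun n => wn n i setT - a i)).
  apply: (squeeze_cvgr _ (cvg_cst 0) e2); apply: nearW => n.
  by rewrite normr_ge0 wnT.
have csG : cell_sum (wn n i) setT (q m) @[n --> G] --> cell_sum (w i) setT (q m).
  apply: cvg_fin_sum => t; apply: (cvgZr_tmp (wcvg i _ _)).
  exact: (measurableI _ _ measurableT (mcell m t)).
have e3 : (eta m + eta n + (eta n + eta n)) @[n --> G] --> eta m + 0 + (0 + 0).
  by apply: cvgD; apply: cvgD => //; exact: cvg_cst.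
rewrite -[leRHS]addr0 -[in leRHS](addr0 (eta m)) -{2}(addr0 0).
have csG' : `|cell_sum (wn n i) setT (q m) - a i *: x i| @[n --> G] -->
    `|cell_sum (w i) setT (q m) - a i *: x i|.
  by apply: cvg_norm; apply: cvgB => //; exact: cvg_cst.
apply: (ler_cvg_to csG' e3); apply: nearW => n.
rewrite -(subrK (cell_sum (wn n i) setT (q n)) (cell_sum (wn n i) setT (q m))).
rewrite -addrA (le_trans (ler_normD _ _))// lerD//.
apply: (cell_sum_dist (nu := nu)) => //.
by move=> A mA; exact: mass_splitting_le (wnS n) mA.
Qed.

End exact_splitting.

(** * Finitely supported laws *)

Section restricted_integral.
Local Open Scope ereal_scope.
Context {R : realType} d (X : measurableType d) (mu : {measure set X -> \bar R}).

Lemma ge0_integral_mrestr (A : set X) (mA : measurable A) (f : X -> \bar R) :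
  (forall x, 0 <= f x) -> measurable_fun setT f ->
  \int[mrestr mu mA]_x f x = \int[mu]_(x in A) f x.
Proof.
move=> f0 mf; rewrite -(setUv A) ge0_integral_setU//; first last.
- exact/disj_setPCl.
- by rewrite setUv.
- exact: measurableC.
rewrite (@eq_measure_integral _ _ _ A mu); last first.
  by move=> C mC CA; rewrite /= /mrestr setIidl.
rewrite (@eq_measure_integral _ _ _ (~` A) mzero); last first.
  move=> C mC CA; rewrite /= /mrestr /mzero.
  suff -> : C `&` A = set0 by exact: measure0.
  by apply/seteqP; split => // x [/CA].
by rewrite integral_measure_zero adde0.
Qed.

End restricted_integral.

Section discrete.
Context {R : realType} {B : completeNormedModType R} (T : finType).
Variables (c : T -> R) (b : T -> B).

Definition discrete_law (P : probability (borel B) R) :=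
  forall A : set (borel B), P A = (\sum_t (c t)%:E * \d_(b t : borel B) A)%E.

Definition discrete_integral (P : probability (borel B) R) :=
  forall f : B -> R, measurable_fun [set: borel B] (f : borel B -> R) ->
  (\int[P]_x (f x)%:E = (\sum_t c t * f (b t))%:E)%E.

Hypotheses (c0 : forall t, 0 <= c t) (c1 : \sum_t c t = 1).

Lemma exists_discrete_law : exists P : probability (borel B) R,
  discrete_law P /\ discrete_integral P.
Proof.
have [|P [PA Pf]] := @exists_mixture R _ (borel B) T c
    (fun t => \d_(b t : borel B)) c0.
  rewrite (eq_bigr (fun t => (c t)%:E)) ?sumEFin ?c1// => t _.
  by rewrite -[RHS]mule1; congr (_ * _)%E; exact: diracT.
exists P; split => // f mf.
have pos h : measurable_fun [set: borel B] (h : borel B -> R) ->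
    (forall x, 0 <= h x) ->
    (\int[P]_x (h x)%:E = (\sum_t c t * h (b t))%:E)%E.
  move=> mh h0; rewrite Pf//; last exact/measurable_EFinP.
    rewrite -sumEFin; apply: eq_bigr => t _; rewrite integral_dirac//.
      by rewrite -[RHS]mul1e EFinM muleCA; congr (_ * _)%E; exact: diracT.
    exact/measurable_EFinP.
rewrite integralE.
rewrite (eq_integral (fun x : borel B => (Num.max (f x) 0)%:E)); last first.
  by move=> x _; rewrite funeposE EFin_max.
rewrite [X in (_ - X)%E](eq_integral (fun x : borel B => (Num.max (- f x) 0)%:E)); last first.
  by move=> x _; rewrite funenegE EFin_max.
rewrite !pos.
- rewrite -EFinB -sumrB; congr _%:E; apply: eq_bigr => t _; rewrite -mulrBr.
  congr (_ * _); have [|] := leP (f (b t)) 0; have [|] := leP (- f (b t)) 0; lra.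
- apply: measurable_maxr => //; exact: measurableT_comp.
- by move=> x; rewrite le_max lexx orbT.
- by apply: measurable_maxr.
- by move=> x; rewrite le_max lexx orbT.
Qed.

End discrete.

(** * Averaging a splitting over the cells of a quantizer *)

Section quantization.
Context {R : realType} {B : completeNormedModType R}.
Variables (nu : probability (borel B) R) (p : R).
Hypotheses (p1 : 1 <= p) (nup : wasserstein_space p nu).
Variables (I : finType) (w : I -> set (borel B) -> R).
Hypothesis wS : mass_splitting nu w.
Variables (q : nat -> @quantizer R B) (eta : nat -> R).
Hypothesis eta_cvg0 : eta @ \oo --> 0.
Hypothesis qeta : forall n, (\int[nu]_y (qerr (q n) y)%:E <= (eta n)%:E)%E.
Hypothesis qetap : forall n, (\int[nu]_y (qerr (q n) y `^ p)%:E <= (eta n)%:E)%E.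
Variable Q : @quantizer R B.

Let cell (t : qindex Q) : set (borel B) := qcell Q @^-1` [set t].

Let mcell t : measurable (cell t). Proof. exact: measurable_qcell. Qed.

Let aw i : fin_additive (w i). Proof. by case: wS. Qed.

Let w_ge0 i A : measurable A -> 0 <= w i A. Proof. by case: wS => _ + _; apply. Qed.

Lemma cell_sum_is_cvg i A : measurable A -> cvg (cell_sum (w i) A (q n) @[n --> \oo]).
Proof.
move=> mA; apply/cauchy_cvgP/cauchyP => e e0.
have [N _ hN] : \forall n \near \oo, eta n < e / 2.
  by apply: cvgr_lt; [exact: eta_cvg0|rewrite divr_gt0].
exists (cell_sum (w i) A (q N)); exists N => // n /= Nn.
rewrite -ball_normE /=.
apply: (@le_lt_trans _ _ (eta N + eta n)).
  apply: (cell_sum_dist (nu := nu)) => //.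
  by move=> C mC; exact: mass_splitting_le.
by rewrite (splitr e) ltrD// hN/=.
Qed.

Let z i t := lim (cell_sum (w i) (cell t) (q n) @[n --> \oo]).

(** The cells of Q are those over which the pieces w i are averaged; the
    quantizers q n, finer and finer, only serve to define barycentres. *)
Definition quantized_weight (k : I * qindex Q) : R := w k.1 (cell k.2).

(** The barycentre of w i on a cell; it is 0 on a cell that w i does not charge,
    where the weight vanishes too. *)
Definition quantized_point (k : I * qindex Q) : B :=
  (w k.1 (cell k.2))^-1 *: z k.1 k.2.

Let z_cvg i t : cell_sum (w i) (cell t) (q n) @[n --> \oo] --> z i t.
Proof. exact: cell_sum_is_cvg. Qed.

Lemma quantized_weight_ge0 k : 0 <= quantized_weight k.
Proof. exact: w_ge0. Qed.

Lemma sum_quantized_weight i : \sum_t quantized_weight (i, t) = w i setT.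
Proof.
rewrite (fin_additive_index mcell (aw i) measurableT).
by apply: eq_bigr => t _; rewrite setTI.
Qed.

Let weight0 i t C : measurable C -> w i (cell t) = 0 -> w i (cell t `&` C) = 0.
Proof.
move=> mC w0; apply/eqP; rewrite eq_le w_ge0 ?andbT; last exact: measurableI.
rewrite -w0; apply: (fin_additive_le (aw i)).
- exact: w_ge0.
- exact: measurableI.
- exact: mcell.
- exact: subIsetl.
Qed.

Lemma scale_quantized_point i t :
  quantized_weight (i, t) *: quantized_point (i, t) = z i t.
Proof.
rewrite /quantized_point /quantized_weight/= scalerA.
have [w0|w0] := eqVneq (w i (cell t)) 0; last by rewrite mulfV// scale1r.
rewrite w0 mul0r scale0r.
have z0 : cell_sum (w i) (cell t) (q n) @[n --> \oo] --> (0 : B).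
  rewrite (_ : (fun n => _) = cst 0); first exact: cvg_cst.
  apply/funext => n; apply: big1 => s _.
  by rewrite weight0 ?scale0r//; exact: measurable_qcell.
apply: (@norm_cvg_unique R B (cell_sum (w i) (cell t) (q n) @[n --> \oo])).
  exact: z0.
exact: z_cvg.
Qed.

Lemma sum_quantized_point i x :
  cell_sum (w i) setT (q n) @[n --> \oo] --> x ->
  \sum_t quantized_weight (i, t) *: quantized_point (i, t) = x.
Proof.
move=> h; under eq_bigr do rewrite scale_quantized_point.
apply: (@norm_cvg_unique R B (cell_sum (w i) setT (q n) @[n --> \oo])) => //.
suff E : (fun n => cell_sum (w i) setT (q n)) =
    (fun n => \sum_t cell_sum (w i) (cell t) (q n)).
  by rewrite /= E; apply: cvg_fin_sum => t; exact: z_cvg.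
apply/funext => n; rewrite [RHS]exchange_big; apply: eq_bigr => s _.
rewrite (fin_additive_index mcell (aw i)) ?scaler_suml; last first.
  by apply: measurableI => //; exact: measurable_qcell.
by apply: eq_bigr => t _; rewrite setTI setIC.
Qed.

(** Jensen's inequality for each piece on each cell, first for the n-th finite
    sums and then in the limit. The function may depend on the cell, and it need
    not be Lipschitz: this is used for the p-th power of the distance to the
    point of the cell. *)
Lemma quantized_jensen (F : qindex Q -> B -> R) (K_ : nat -> R) (K : R) :
  (forall t, convex_fun (F t)) -> (forall t, continuous (F t)) ->
  K_ @ \oo --> K ->
  (forall n, \sum_t \sum_s
     mass nu (cell t `&` qcell (q n) @^-1` [set s]) * F t (qpoint s) <= K_ n) ->
  \sum_k quantized_weight k * F k.2 (quantized_point k) <= K.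
Proof.
move=> Fc Fcont KK hK.
have lhs : (\sum_(k : I * qindex Q) quantized_weight k * F k.2
      ((w k.1 (cell k.2))^-1 *: cell_sum (w k.1) (cell k.2) (q n)))
    @[n --> \oo] --> \sum_k quantized_weight k * F k.2 (quantized_point k).
  apply: (@cvg_fin_sum R R^o) => -[i t]; apply: cvgM; first exact: cvg_cst.
  apply: continuous_cvg; first exact: Fcont.
  by apply: cvgZ; [exact: cvg_cst|exact: z_cvg].
apply: (ler_cvg_to lhs KK); apply: nearW => n; apply: le_trans (hK n).
rewrite sum_pair exchange_big/=.
apply: ler_sum => t _.
apply: (@le_trans _ _ (\sum_i \sum_s
    w i (cell t `&` qcell (q n) @^-1` [set s]) * F t (qpoint s))).
  apply: ler_sum => i _; rewrite /quantized_weight/=.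
  have mc := @measurable_qcell _ _ (q n).
  rewrite (fin_additive_index mc (aw i) (mcell t)).
  apply: jensen_fin => // s; apply: w_ge0; exact: measurableI.
rewrite exchange_big/=; apply: ler_sum => s _; rewrite -mulr_suml.
case: wS => _ _ ->//; apply: measurableI => //; exact: measurable_qcell.
Qed.

Lemma quantized_le_convex L f : 0 <= L -> lipschitz_le L f -> convex_fun f ->
  \sum_k quantized_weight k * f (quantized_point k) <= \int[nu]_y f y.
Proof.
move=> L0 Lf cf.
apply: (@quantized_jensen (fun=> f) (fun n => \int[nu]_y f y + L * eta n)) => //.
- by move=> _; exact: lipschitz_le_continuous Lf.
- rewrite -[X in _ --> X]addr0 -(mulr0 L); apply: cvgD; first exact: cvg_cst.
  by apply: cvgM => //; exact: cvg_cst.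
- move=> n; rewrite exchange_big/=.
  rewrite (eq_bigr (fun s : qindex (q n) => qmass nu s * f (qpoint s))).
    have := lipschitz_quantizer p1 nup L0 Lf (qeta n).
    by rewrite ler_norml => /andP[_]; rewrite lerBlDl.
  move=> s _; rewrite -mulr_suml; congr (_ * _).
  have ms : measurable (qcell (q n) @^-1` [set s] : set (borel B)).
    exact: measurable_qcell.
  rewrite [RHS](fin_additive_index mcell (fin_additive_mass nu) ms).
  by apply: eq_bigr => t _; rewrite setIC.
Qed.

Lemma convex_powR_norm (d : B) : convex_fun (fun x : B => `|x - d| `^ p).
Proof.
move=> t x y t01; have /andP[t0 t1] := t01; have t1' : 0 <= 1 - t by rewrite subr_ge0.
have p0 : 0 <= p by exact: le_trans p1.
apply: (@le_trans _ _ ((t * `|x - d| + (1 - t) * `|y - d|) `^ p)).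
  apply: ge0_ler_powR; rewrite ?nnegrE ?addr_ge0 ?mulr_ge0//.
  rewrite (_ : _ - d = t *: (x - d) + (1 - t) *: (y - d)).
    by rewrite (le_trans (ler_normD _ _))// !normrZ !ger0_norm.
  by rewrite !scalerBr addrACA -opprD -scalerDl subrKC scale1r.
have := @convex_powR R p p1 (Itv01 t0 t1) `|x - d| `|y - d|.
by rewrite !inE/= !in_itv/= !andbT !normr_ge0; apply.
Qed.

Variable etaQ : R.
Hypothesis Qeta : (\int[nu]_y (qerr Q y `^ p)%:E <= etaQ%:E)%E.

(** By Jensen's inequality, averaging over a cell does not increase the mean p-th
    power of the distance to the point of the cell. The factor 2^p comes from
    the comparison of q n and Q through the identity; the error of q n
    disappears in the limit. *)
Lemma quantized_cell_error :
  \sum_k quantized_weight k * `|quantized_point k - qpoint k.2| `^ p <=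
  2 `^ p * etaQ.
Proof.
have p0 : 0 <= p by exact: le_trans p1.
have mq (q' : @quantizer R B) : measurable_fun [set: borel B] (fun y => qerr q' y `^ p).
  by apply: (measurableT_comp (measurable_powR p)); exact: measurable_qerr.
apply: (@quantized_jensen (fun t x => `|x - qpoint t| `^ p)
   (fun n => 2 `^ p * (eta n + etaQ))).
- by move=> t; exact: convex_powR_norm.
- by move=> t; exact: continuous_powR_norm.
- rewrite -[X in _ * X]add0r; apply: cvgM; first exact: cvg_cst.
  by apply: cvgD => //; exact: cvg_cst.
- move=> n; apply: (@integral_pair_cells _ _ nu Q (q n)
    (fun t s => `|qpoint s - qpoint t| `^ p)
    (fun y => 2 `^ p * (qerr (q n) y `^ p + qerr Q y `^ p))).
  + by apply: measurable_funM => //; apply: measurable_funD; exact: mq.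
  + by move=> t s; exact: powR_ge0.
  + move=> y; apply: (le_trans _ (powR_addM p1 (normr_ge0 _) (normr_ge0 _))).
    apply: ge0_ler_powR; rewrite ?nnegrE ?addr_ge0//.
    rewrite -{1}(subrK y (qpoint (qcell (q n) y))) -addrA.
    by rewrite (le_trans (ler_normD _ _))// lerD2l distrC.
  + under eq_integral do rewrite EFinM.
    rewrite ge0_integralZl//.
    * rewrite EFinM; apply: lee_wpmul2l; first by rewrite lee_fin powR_ge0.
      under eq_integral do rewrite EFinD.
      rewrite ge0_integralD//.
      - by rewrite EFinD leeD.
      - by move=> y _; rewrite lee_fin powR_ge0.
      - exact/measurable_EFinP.
      - by move=> y _; rewrite lee_fin powR_ge0.
      - exact/measurable_EFinP.
    * by apply/measurable_EFinP; apply: measurable_funD; exact: mq.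
    * by move=> y _; rewrite lee_fin addr_ge0// powR_ge0.
Qed.

End quantization.

(** * Transport cost of the averaging *)

Section coupling_bound.
Context {R : realType} {B : completeNormedModType R}.
Variables (nu : probability (borel B) R) (p : R).
Hypothesis p1 : 1 <= p.

Lemma wasserstein_ge0 (mu1 mu2 : probability (borel B) R) :
  (0 <= wasserstein p mu1 mu2)%E.
Proof. exact: poweR_ge0. Qed.

Lemma measurable_dist_powR : measurable_fun [set: borel (B * B)%type]
  (fun z : borel (B * B)%type => `|z.1 - z.2 : B| `^ p : R).
Proof.
apply: (measurableT_comp (measurable_powR p)).
apply: measurable_fun_real_generated => a b.
apply: open_comp; last exact: interval_open.
move=> z _.
apply: (@continuous_comp _ _ _ (fun z : B * B => z.1 - z.2) (fun y => `|y|)).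
  by apply: cvgB; [exact: cvg_fst|exact: cvg_snd].
exact: norm_continuous.
Qed.

Lemma wasserstein_le (mu1 mu2 : probability (borel B) R)
    (pi : probability (borel (B * B)%type) R) (e : R) :
  0 <= e -> coupling mu1 mu2 pi ->
  (\int[pi]_z (`|z.1 - z.2 : B| `^ p)%:E <= (e `^ p)%:E)%E ->
  (wasserstein p mu1 mu2 <= e%:E)%E.
Proof.
move=> e0 cpi pie; have p0 : 0 < p by exact: lt_le_trans p1.
have -> : e%:E = poweR (e `^ p)%:E p^-1.
  by rewrite poweR_EFin -powRrM mulfV ?gt_eqF// powRr1.
have inf0 : (0 <= ereal_inf [set (\int[pi]_z (`|z.1 - z.2 : B| `^ p)%:E)%E
                   | pi in coupling mu1 mu2])%E.
  apply: le_ereal_inf_tmp => _ [pi' _ <-]; apply: integral_ge0 => z _.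
  by rewrite lee_fin powR_ge0.
apply: gt0_ler_poweR.
- by rewrite invr_ge0 ltW.
- by rewrite in_itv/= inf0 leey.
- by rewrite in_itv/= lee_fin powR_ge0 leey.
- by apply: le_trans pie; apply: ereal_inf_lbound; exists pi.
Qed.

(** The image of the restriction of nu to A under y |-> (b, y): all of A is
    transported to b. *)
Lemma exists_graph_measure (A : set (borel B)) (b : B) : measurable A ->
  exists M : {measure set (borel (B * B)%type) -> \bar R},
    (forall C, M C = nu ([set y : borel B | C (b, y)] `&` A)) /\
    (forall f : borel (B * B)%type -> \bar R, (forall z, 0 <= f z)%E ->
       measurable_fun setT f ->
       \int[M]_z f z = \int[nu]_(y in A) f (b, y))%E.
Proof.
move=> mA; pose g (y : borel B) : borel (B * B)%type := (b, y).
have mg : measurable_fun setT g.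
  apply: measurable_fun_generated => C oC; apply: open_comp oC => y _.
  by apply: cvg_pair; [exact: cvg_cst|exact: cvg_id].
unshelve refine (ex_intro _ (pushforward (mrestr nu mA) g :
  {measure set (borel (B * B)%type) -> \bar R}) _); first exact: mg.
split => // f f0 mf; rewrite ge0_integral_pushforward//.
rewrite preimage_setT ge0_integral_mrestr//; first by move=> y; exact: f0.
exact: measurableT_comp.
Qed.

Variables (I : finType) (w : I -> set (borel B) -> R).
Hypothesis wS : mass_splitting nu w.
Variables (Q : @quantizer R B) (etaQ : R).
Hypothesis Qeta : (\int[nu]_y (qerr Q y `^ p)%:E <= etaQ%:E)%E.
Variable b : I * qindex Q -> B.
Let c (k : I * qindex Q) : R := quantized_weight w k.
Hypothesis b_err : \sum_k c k * `|b k - qpoint k.2| `^ p <= 2 `^ p * etaQ.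

Let cell (t : qindex Q) : set (borel B) := qcell Q @^-1` [set t].
Let mcell t : measurable (cell t). Proof. exact: measurable_qcell. Qed.
Let coef k : R := c k / mass nu (cell k.2).

Let sum_c t : \sum_i c (i, t) = mass nu (cell t).
Proof. by case: wS => _ _ /(_ (cell t) (mcell t)). Qed.

Let c_ge0 k : 0 <= c k.
Proof. exact: (quantized_weight_ge0 wS). Qed.

Let coef_ge0 k : 0 <= coef k.
Proof. by rewrite /coef divr_ge0//; exact: mass_ge0. Qed.

Let coef_mass k : coef k * mass nu (cell k.2) = c k.
Proof.
rewrite /coef; have [m0|m0] := eqVneq (mass nu (cell k.2)) 0; last by rewrite divfK.
rewrite m0 mulr0; apply/esym/eqP; rewrite eq_le c_ge0 andbT -m0 -sum_c.
by case: k {m0} => i t /=; rewrite (bigD1 i)//= lerDl sumr_ge0.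
Qed.

Let sum_coef t : \sum_i coef (i, t) * mass nu (cell t) = mass nu (cell t).
Proof. by under eq_bigr do rewrite (coef_mass (_, t)); exact: sum_c. Qed.

Let massE A : measurable A -> nu A = (mass nu A)%:E.
Proof. by move=> mA; rewrite fineK// fin_num_measure. Qed.

(** Inside the cell t, the mass w i (cell t) is moved to its barycentre
    b (i, t) from all over the cell, proportionally to nu: the coupling is the
    mixture of the images of nu restricted to cell t under y |-> (b (i, t), y),
    with coefficients w i (cell t) / nu (cell t). Its cost is controlled by going
    through the point of the cell, which is close to b (i, t) by b_err and to
    the points of the cell by Qeta. *)
Lemma quantized_wasserstein (P : probability (borel B) R) (e : R) :
  discrete_law c b P -> 0 <= e ->
  2 `^ p * (2 `^ p * etaQ + etaQ) <= e `^ p ->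
  (wasserstein p P nu <= e%:E)%E.
Proof.
move=> Plaw e0 small.
have p0 : 0 <= p by exact: le_trans p1.
pose exM k := cid (exists_graph_measure (b k) (mcell k.2)).
pose M k := projT1 (exM k).
have ME k C : M k C = nu ([set y : borel B | C (b k, y)] `&` cell k.2).
  exact: (projT2 (exM k)).1.
have Mf k := (projT2 (exM k)).2; rewrite -/(M _) in Mf.
have sumc : \sum_k c k = 1.
  rewrite sum_pair exchange_big/= -[RHS](congr1 fine (probability_setT nu)).
  rewrite [RHS](fin_additive_index mcell (fin_additive_mass nu) measurableT).
  by apply: eq_bigr => t _; rewrite setTI sum_c.
have [|pi [piE pif]] := exists_mixture (m := M) coef_ge0.
  rewrite (eq_bigr (fun k => (c k)%:E)) ?sumEFin ?sumc// => k _.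
  by rewrite ME setTI massE// -EFinM coef_mass.
apply: (@wasserstein_le _ _ pi) => //.
  move=> A mA; split; rewrite /pushforward piE.
    rewrite Plaw; apply: eq_bigr => k _; rewrite ME diracE /=.
    have [Ab|nAb] := boolP (b k \in A).
      rewrite mule1 (_ : [set _ | _] = setT) ?setTI ?massE -?EFinM ?coef_mass//.
      by apply/seteqP; split => // y _ /=; rewrite inE in Ab.
    rewrite mule0 (_ : [set _ | _] = set0) ?set0I ?measure0 ?mule0//.
    by apply/seteqP; split => // y /= Ab; move: nAb; rewrite notin_setE.
  have mAc t : measurable (A `&` cell t) by exact: measurableI.
  rewrite (eq_bigr (fun k => (coef k * mass nu (A `&` cell k.2))%:E)); last first.
    by move=> k _; rewrite ME massE//.
  rewrite sumEFin massE// (fin_additive_index mcell (fin_additive_mass nu) mA).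
  congr EFin; rewrite sum_pair exchange_big/=; apply: eq_bigr => t _; rewrite -mulr_suml.
  have := sum_coef t; rewrite -mulr_suml.
  (* the coefficients over a charged cell add up to 1; a null
     cell contributes 0 to both sides *)
  have [m0 _|m0 /(canRL (mulfK m0))] := eqVneq (mass nu (cell t)) 0; last first.
    by rewrite mulfV// => ->; rewrite mul1r.
  suff -> : mass nu (A `&` cell t) = 0 by rewrite mulr0.
  apply/eqP; rewrite eq_le mass_ge0 andbT -m0.
  apply: (fin_additive_le (fin_additive_mass nu)).
  - by move=> C _; exact: mass_ge0.
  - exact: mAc.
  - exact: mcell.
  - exact: subIsetr.
have mQ : measurable_fun [set: borel B] (fun y : borel B => (qerr Q y `^ p)%:E).
  apply/measurable_EFinP; apply: (measurableT_comp (measurable_powR p)).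
  exact: measurable_qerr.
have Q0 (y : borel B) : (0 <= (qerr Q y `^ p)%:E)%E by rewrite lee_fin powR_ge0.
pose J t := (\int[nu]_(y in cell t) (qerr Q y `^ p)%:E)%E.
have sumJ : (\sum_t J t <= etaQ%:E)%E.
  by rewrite -(ge0_integral_index mcell nu Q0 mQ).
have J0 t : (0 <= J t)%E by exact: integral_ge0.
have Jfin t : J t \is a fin_num.
  rewrite ge0_fin_numE//; apply: (le_lt_trans _ (ltry etaQ)).
  apply: le_trans sumJ; rewrite (bigD1 t)//= leeDl// sume_ge0//.
rewrite pif; last 2 first.
- by move=> z; rewrite lee_fin powR_ge0.
- by apply/measurable_EFinP; exact: measurable_dist_powR.
apply: (@le_trans _ _ (\sum_k (coef k * (2 `^ p *
    (`|b k - qpoint k.2| `^ p * mass nu (cell k.2) + fine (J k.2))))%:E)%E).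
  apply: lee_sum => k _; rewrite [leRHS]EFinM; apply: lee_wpmul2l; first by rewrite lee_fin.
  rewrite Mf; last 2 first.
  - by move=> z; rewrite lee_fin powR_ge0.
  - by apply/measurable_EFinP; exact: measurable_dist_powR.
  apply: (@le_trans _ _ (\int[nu]_(y in cell k.2) ((2 `^ p)%:E *
      ((`|b k - qpoint k.2| `^ p)%:E + (qerr Q y `^ p)%:E)))%E).
    apply: ge0_le_integral => //.
    - apply/measurable_EFinP; apply: (measurableT_comp (measurable_powR p)).
      apply: measurable_funTS; exact: measurable_dist.
    - apply: measurable_funTS; apply: emeasurable_funM => //.
      exact: emeasurable_funD.
    - move=> y yc; rewrite -EFinD -EFinM lee_fin /=.
      apply: (le_trans _ (powR_addM p1 (normr_ge0 _) (normr_ge0 _))).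
      apply: ge0_ler_powR; rewrite ?nnegrE ?addr_ge0//.
      rewrite /qerr yc -{1}(subrK (qpoint k.2) (b k)) -addrA.
      by rewrite (le_trans (ler_normD _ _)).
  rewrite ge0_integralZl//.
  - rewrite [leRHS]EFinM; apply: lee_wpmul2l; first by rewrite lee_fin powR_ge0.
    rewrite ge0_integralD//.
    + rewrite EFinD EFinM -massE// fineK//.
      by rewrite integral_cst.
    + by apply: measurable_funTS.
  - apply: measurable_funTS; exact: emeasurable_funD.
  - by move=> y _; rewrite adde_ge0// lee_fin powR_ge0.
rewrite sumEFin lee_fin; apply: le_trans small.
rewrite (eq_bigr (fun k => 2 `^ p * (c k * `|b k - qpoint k.2| `^ p
    + coef k * fine (J k.2)))); last first.
  by move=> k _; rewrite -(coef_mass k); ring.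
rewrite -mulr_sumr ler_wpM2l ?powR_ge0// big_split/= lerD//.
rewrite sum_pair exchange_big/=.
rewrite -lee_fin; apply: le_trans sumJ.
rewrite -sumEFin; apply: lee_sum => t _; rewrite -[leRHS](fineK (Jfin t)) lee_fin.
rewrite -mulr_suml ler_piMl ?fine_ge0//.
have := sum_coef t; rewrite -mulr_suml.
have [m0 _|m0 /(canRL (mulfK m0)) ->] := eqVneq (mass nu (cell t)) 0; last first.
  by rewrite mulfV.
by rewrite big1// => i _; rewrite /coef /= m0 invr0 mulr0.
Qed.

End coupling_bound.

(** * Finitely supported approximations in convex order *)

Section assembly.
Context {R : realType} {B : completeNormedModType R}.
Variables (p : R) (sepB : separable B) (p1 : 1 <= p).

Lemma exists_quantizer_sequence (nu : probability (borel B) R) :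
  wasserstein_space p nu -> exists q : nat -> @quantizer R B, forall n,
    (\int[nu]_y (qerr (q n) y `^ p)%:E <= (harmonic n)%:E)%E /\
    (\int[nu]_y (qerr (q n) y)%:E <= (harmonic n)%:E)%E.
Proof.
move=> nup; pose ex n := cid (exists_quantizer sepB p1 nup (harmonic_gt0 n)).
exists (fun n => projT1 (ex n)) => n; exact: projT2 (ex n).
Qed.

Lemma quantize_splitting (nu : probability (borel B) R)
    (nup : wasserstein_space p nu) (q : nat -> @quantizer R B)
    (qP : forall n, (\int[nu]_y (qerr (q n) y `^ p)%:E <= (harmonic n)%:E)%E /\
      (\int[nu]_y (qerr (q n) y)%:E <= (harmonic n)%:E)%E)
    (I : finType) (w : I -> set (borel B) -> R) (wS : mass_splitting nu w)
    (e : R) : 0 < e ->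
  exists (T : finType) (c : I * T -> R) (b : I * T -> B),
    [/\ forall k, 0 <= c k,
        forall i, \sum_t c (i, t) = w i setT,
        forall i x, cell_sum (w i) setT (q n) @[n --> \oo] --> x ->
          \sum_t c (i, t) *: b (i, t) = x,
        forall L f, 0 <= L -> lipschitz_le L f -> convex_fun f ->
          \sum_k c k * f (b k) <= \int[nu]_y f y &
        forall P, discrete_law c b P -> (wasserstein p P nu <= e%:E)%E].
Proof.
move=> e0.
(* the factor by which quantized_wasserstein multiplies the error of Q *)
pose C := 2 `^ p * (2 `^ p + 1) : R.
have C0 : 0 < C by rewrite mulr_gt0 ?addr_gt0 ?powR_gt0.
have [M hM] : exists M, harmonic M < e `^ p / C.
  have [M _ /(_ M (leqnn _)) h] : \forall n \near \oo, @harmonic R n < e `^ p / C.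
    by apply: cvgr_lt; [exact: cvg_harmonic|rewrite divr_gt0// powR_gt0].
  by exists M.
have q1 n := (qP n).2; have qp n := (qP n).1.
exists (qindex (q M)), (quantized_weight w (Q := q M)), (quantized_point w q (Q := q M)).
split.
- exact: (quantized_weight_ge0 wS).
- exact: (sum_quantized_weight wS).
- by move=> i x; exact: (sum_quantized_point wS cvg_harmonic q1).
- by move=> L f; exact: (quantized_le_convex p1 nup wS cvg_harmonic q1).
- move=> P PL; apply: (quantized_wasserstein p1 wS (qp M) _ PL (ltW e0)).
    exact: (quantized_cell_error p1 wS cvg_harmonic q1 qp (qp M)).
  move: hM; rewrite ltr_pdivlMr// => /ltW; apply: le_trans.
  by rewrite /C le_eqVlt; apply/orP; left; apply/eqP; ring.
Qed.

Lemma lipschitz_measurable L (f : B -> R) : lipschitz_le L f ->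
  measurable_fun [set: borel B] (f : borel B -> R).
Proof.
by move=> Lf; apply: continuous_borel_measurable; exact: lipschitz_le_continuous Lf.
Qed.

Section discrete_laws.
Variables (T : finType) (c : T -> R) (b : T -> B) (P : probability (borel B) R).
Hypotheses (c0 : forall t, 0 <= c t) (c1 : \sum_t c t = 1).
Hypotheses (PL : discrete_law c b P) (PI : discrete_integral c b P).

Lemma discrete_finitely_supported : finitely_supported P.
Proof.
exists (b @` setT); first exact: finite_image.
rewrite PL -c1 -sumEFin; apply: eq_bigr => t _.
by rewrite diracE mem_set ?mule1//; exists t.
Qed.

Lemma discrete_wasserstein_space : wasserstein_space p P.
Proof.
rewrite /wasserstein_space /=.
rewrite (PI (f := fun x => `|x| `^ p)) ?ltry//.
apply: (measurableT_comp (measurable_powR p)).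
by apply: continuous_borel_measurable; exact: norm_continuous.
Qed.

Lemma discrete_convex_order (nu : probability (borel B) R) :
  wasserstein_space p nu ->
  (forall L f, 0 <= L -> lipschitz_le L f -> convex_fun f ->
     \sum_t c t * f (b t) <= \int[nu]_y f y) ->
  convex_order P nu.
Proof.
move=> nup h f /lipschitz_leP[L L0 Lf] /convex_functionP cf.
rewrite PI; last exact: lipschitz_measurable Lf.
rewrite -(fineK (integrable_fin_num measurableT
  (integrable_lipschitz p1 nup L0 Lf))) lee_fin.
exact: h L0 Lf cf.
Qed.

End discrete_laws.

(** The i-th atom of the first law is split into the atoms (i, t) of the second
    one with the same barycentre. *)
Lemma jensen_discrete (I T : finType) (a : I -> R) (x : I -> B)
    (c : I * T -> R) (b : I * T -> B) (f : B -> R) :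
  convex_fun f -> (forall k, 0 <= c k) -> (forall i, \sum_t c (i, t) = a i) ->
  (forall i, \sum_t c (i, t) *: b (i, t) = a i *: x i) ->
  \sum_i a i * f (x i) <= \sum_k c k * f (b k).
Proof.
move=> cf c0 ca cx.
rewrite sum_pair; apply: ler_sum => i _.
have := jensen_fin (fun t => b (i, t)) cf (fun t => c0 (i, t)).
rewrite ca cx scalerA; have [->|ai] := eqVneq (a i) 0; first by rewrite !mul0r.
by rewrite mulVf// scale1r.
Qed.

(** mu is averaged as a splitting into a single piece; the resulting atoms then
    prescribe the masses and barycentres of a splitting of nu. *)
Lemma convex_order_approximation (mu nu : probability (borel B) R) (e : R) :
  wasserstein_space p mu -> wasserstein_space p nu -> convex_order mu nu ->
  0 < e -> exists PQ : probability (borel B) R * probability (borel B) R,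
    [/\ finitely_supported PQ.1 /\ finitely_supported PQ.2,
        wasserstein_space p PQ.1 /\ wasserstein_space p PQ.2,
        convex_order PQ.1 PQ.2,
        (wasserstein p PQ.1 mu <= e%:E)%E /\ (wasserstein p PQ.2 nu <= e%:E)%E
      & convex_order PQ.1 mu /\ convex_order PQ.2 nu].
Proof.
move=> mup nup munu e0.
have [qm qmP] := exists_quantizer_sequence mup.
have [qn qnP] := exists_quantizer_sequence nup.
have muS : mass_splitting mu (fun _ : unit => mass mu).
  split => [_|_ A _|A _]; [exact: fin_additive_mass|exact: mass_ge0|].
  by rewrite big_const cardT /= enumT unlock /= addr0.
have [T [a [x [a0 asum _ amu aW]]]] := quantize_splitting mup qmP muS e0.
have a1 : \sum_k a k = 1.
  rewrite sum_pair; under eq_bigr do rewrite asum.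
  by rewrite big_const cardT /= enumT unlock /= addr0 /mass probability_setT.
have anu f : lipschitz_le 1 f -> convex_fun f ->
    \sum_k a k * f (x k) <= \int[nu]_y f y.
  move=> lf cf; apply: le_trans (amu 1 f ler01 lf cf) _; rewrite -lee_fin.
  rewrite !fineK; try by apply: integrable_fin_num => //;
    exact: (integrable_lipschitz p1 _ ler01 lf).
  apply: munu; first exact: (lipschitz_le_lipschitz lf).
  exact/convex_functionP.
have [w [wS wa wx]] := exists_exact_splitting p1 nup a0 a1 anu
  (@harmonic_gt0 R) cvg_harmonic (fun n => (qnP n).2).
have [T' [c [b [c0 csum cx cnu cW]]]] := quantize_splitting nup qnP wS e0.
have c1 : \sum_k c k = 1.
  rewrite sum_pair -a1.
  by apply: eq_bigr => i _; rewrite csum wa.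
have cax i : \sum_t c (i, t) *: b (i, t) = a i *: x i.
  apply: cx; apply/subr_cvg0; apply: norm_cvg0.
  apply: (squeeze_cvgr _ (cvg_cst 0) cvg_harmonic); apply: nearW => n.
  by rewrite normr_ge0 wx.
have [P [PL PI]] := exists_discrete_law x a0 a1.
have [Q [QL QI]] := exists_discrete_law b c0 c1.
exists (P, Q); split => /=.
- split; [exact: discrete_finitely_supported PL|exact: discrete_finitely_supported QL].
- split; [exact: discrete_wasserstein_space PI|exact: discrete_wasserstein_space QI].
- apply: (discrete_convex_order PI).
    exact: discrete_wasserstein_space QI.
  move=> L f L0 Lf cf; rewrite /Rintegral QI; last exact: lipschitz_measurable Lf.
  by apply: jensen_discrete => // i; rewrite csum wa.
- by split; [exact: aW|exact: cW].
- split; first exact: (discrete_convex_order PI mup amu).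
  exact: (discrete_convex_order QI nup cnu).
Qed.

End assembly.

Theorem theorem5 (R : realType) (B : completeNormedModType R)
    (sepB : separable B) (p : R) (p1 : 1 <= p)
    (mu nu : probability (borel B) R)
    (mu_p : wasserstein_space p mu) (nu_p : wasserstein_space p nu)
    (mu_nu : convex_order mu nu) :
  exists mu_ nu_ : nat -> probability (borel B) R,
    [/\ forall n, finitely_supported (mu_ n) /\ finitely_supported (nu_ n),
        forall n, wasserstein_space p (mu_ n) /\ wasserstein_space p (nu_ n),
        forall n, convex_order (mu_ n) (nu_ n),
        wasserstein p (mu_ n) mu @[n --> \oo] --> 0%E /\
        wasserstein p (nu_ n) nu @[n --> \oo] --> 0%E
      & forall n, convex_order (mu_ n) mu /\ convex_order (nu_ n) nu].
Proof.
pose ex n := cid (convex_order_approximation sepB p1 mu_p nu_p mu_nu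
  (@harmonic_gt0 R n)).
have PQ n := projT2 (ex n); rewrite /= in PQ.
have harm0 : (@harmonic R n)%:E @[n --> \oo] --> 0%E.
  by apply: cvg_EFin; [exact: nearW|exact: cvg_harmonic].
have cvg0 (u : nat -> \bar R) : (forall n, 0 <= u n <= (harmonic n)%:E)%E ->
    u @ \oo --> 0%E.
  by move=> h; apply: (squeeze_cvge _ (cvg_cst 0%E) harm0); apply: nearW => n; exact: h.
exists (fun n => (projT1 (ex n)).1), (fun n => (projT1 (ex n)).2); split => [n|n|n||n].
- by case: (PQ n).
- by case: (PQ n).
- by case: (PQ n).
- split; apply: cvg0 => n; rewrite wasserstein_ge0.
    by case: (PQ n) => _ _ _ [].
  by case: (PQ n) => _ _ _ [].
- by case: (PQ n).
Qed.
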